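(* Let $\mathcal T\equiv(\mathcal T,\mathcal F)$ be a set of prototiles, let $X$ be a non-compact metric space, and let $\Delta$ denote the maximum number of faces of the prototiles in $\mathcal T$. Then: (1) if $X$ has a tiling by $\mathcal T$, then $X$ has a limit aperiodic tiling by at most $2|\mathcal T|\Delta(\Delta-1)$ prototiles; (2) if $X$ has a repetitive tiling by $\mathcal T$, then $X$ has a repetitive limit aperiodic tiling by at most $2|\mathcal T|\Delta(\Delta-1)$ prototiles.
   Context: An $n$-complex is a connected topological space with a simplicial complex structure of dimension $n$. A set of prototiles $(\mathcal T,\mathcal F)$ consists of a finite collection $\mathcal T$ of compact metric $n$-complexes (prototiles) and a collection $\mathcal F$ of subcomplexes of dimension $<n$ of them (faces; a face may be shared by several prototiles), with an involution $o:\mathcal F\to\mathcal F$ (opposition). A tiling $\alpha$ of a metric space $X$ by $\mathcal T$ is a collection of isometries $a_\lambda:t_\lambda\to t'_\lambda\in\mathcal T$ with $t_\lambda\subset X$ (the $t_\lambda$ are the tiles, with faces defined via $a_\lambda$) such that: $X=\bigcup_\lambda t_\lambda$; the complement in $t_\lambda$ of its faces is the interior $\mathrm{Int}(t_\lambda)$ in $X$; if $\mathrm{Int}(t_\lambda\cup t_{\lambda'})\ne\mathrm{Int}(t_\lambda)\cup\mathrm{Int}(t_{\lambda'})$, then $t_\lambda$ and $t_{\lambda'}$ intersect along a face, which is $f$ in $t_\lambda$ and $o(f)$ in $t_{\lambda'}$; and no tile has free faces. A ''tiling of $X$ by at most $k$ prototiles'' is a tiling of $X$ by some set of prototiles $(\mathcal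 T',\mathcal F')$ with $|\mathcal T'|\le k$. A tiling defines a simple graph $G$ whose vertices are the tiles, with an edge between two tiles if they meet along a face. For the tilings considered, $G$ is connected, with degree at most the maximum number of faces of the prototiles. Patches: for a tile $t$ and $r\in\mathbb{N}$, $P(t,r)$ is the union of the tiles at distance $\le r$ from $t$ in $G$. An isomorphism from a patch $P(t,r)$ of a tiling $\{a_\lambda\}$ of $X$ to a patch $P(s,r)$ of a tiling $\{b_\mu\}$ of $Y$ by the same set of prototiles is an isometry $h:P(t,r)\to P(s,r)$ with $h(t)=s$ that carries the tiles of the first patch bijectively to the tiles of the second one, with $b_\mu\circ h=a_\lambda$ on $t_\lambda$ when $h(t_\lambda)=s_\mu$. A tiling $\beta$ of a metric space $Y$, with a base tile $s$, is a limit of a tiling $\alpha$ of $X$ by the same set of prototiles if for every $r\in\mathbb{N}$ some patch $P(t,r)$ of $\alpha$ is isomorphic to the patch $P(s,r)$ of $\beta$. A tiling $\beta=\{b_\mu\}$ of $Y$ is aperiodic if the only isometry of $Y$ which preserves it (maps tiles to tiles compatibly with the maps $b_\mu$) is the identity. A tiling is limit aperiodic if all of its limits are aperiodic. It is repetitive if there is a tile $t_0$ such that for arbitrarily large $r$ the set of tiles $t$ for which $P(t,r)$ is isomorphic to $P(t_0,r)$ is relatively dense in $G$ (every tile is at bounded $G$-distance from it). *)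

(* Defs.v *)
From HB Require Import structures.
From mathcomp Require Import all_boot all_order all_algebra.
From mathcomp Require Import all_classical all_reals all_analysis.

Set Implicit Arguments.
Unset Strict Implicit.
Unset Printing Implicit Defensive.

Import Order.TTheory GRing.Theory Num.Theory.
Import numFieldNormedType.Exports.

Local Open Scope classical_set_scope.
Local Open Scope ring_scope.

Definition isometry_on (R : realType) (X Y : metricType R) (D : set X)
    (h : X -> Y) : Prop :=
  forall x y, D x -> D y -> mdist (h x) (h y) = mdist x y.

(* Points are described by their barycentric coordinates. *)
Definition realization (R : realType) (N : nat) (K : {set {set 'I_N}}) :
    set 'rV[R]_N :=
  [set x | [/\ forall i, 0 <= x 0 i,
               \sum_i x 0 i = 1 &
               [set i | x 0 i != 0]%SET \in K]].

(* Only compact complexes are needed, and a compact simplicial complex has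
   finitely many simplices: the vertices are 'I_mc_nvert, and the topology of
   the realization is the one induced by 'rV_mc_nvert. The simplices are
   nonempty. *)
Record metric_complex (R : realType) := MetricComplex {
  mc_space :> metricType R;
  mc_nvert : nat;
  mc_simplices : {set {set 'I_mc_nvert}};
  mc_coord : mc_space -> 'rV[R]_mc_nvert;
  mc_point : 'rV[R]_mc_nvert -> mc_space;
  mc_simplex_neq0 : finset.set0 \notin mc_simplices;
  mc_simplex_face : forall s s' : {set 'I_mc_nvert},
    s' \subset s -> s' != finset.set0 -> s \in mc_simplices ->
    s' \in mc_simplices;
  mc_vertex : forall i, [set i]%SET \in mc_simplices;
  mc_coord_realization : forall x, realization mc_simplices (mc_coord x);
  mc_coord_continuous : continuous mc_coord;
  mc_point_continuous :
    {within realization mc_simplices, continuous mc_point};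
  mc_coordK : cancel mc_coord mc_point;
  mc_pointK : forall p, realization mc_simplices p -> mc_coord (mc_point p) = p
}.

Definition has_dim (R : realType) (C : metric_complex R) (n : nat) : Prop :=
  \max_(s in mc_simplices C) #|s| = n.+1.

(* i embeds C isometrically as a subcomplex of D: it is affine on simplices
   and is induced by an injective map of vertices preserving simplices. *)
Definition subcomplex_inclusion (R : realType) (C D : metric_complex R)
    (i : C -> D) : Prop :=
  isometry_on setT i /\
  exists v : 'I_(mc_nvert C) -> 'I_(mc_nvert D),
    [/\ injective v,
        forall s, s \in mc_simplices C -> (v @: s)%SET \in mc_simplices D &
        forall x w,
          mc_coord (i x) 0 w = \sum_(u | v u == w) mc_coord x 0 u].

(* [face] is the collection of faces of all the prototiles and [faces t] is the
   set of those that are faces of t; a face may belong to several prototiles.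
   The inclusion [face_incl t f] is meaningful only for f in [faces t].
   [has_dim] makes faces nonempty. Distinct faces of a prototile are distinct
   subcomplexes of it. *)
Record prototiles (R : realType) (n : nat) := Prototiles {
  prototile : finType;
  face : finType;
  tile_complex : prototile -> metric_complex R;
  face_complex : face -> metric_complex R;
  faces : prototile -> {set face};
  face_incl : forall t f, face_complex f -> tile_complex t;
  opp_face : face -> face;
  prototile_compact : forall t, compact [set: tile_complex t];
  prototile_connected : forall t, connected [set: tile_complex t];
  prototile_dim : forall t, has_dim (tile_complex t) n;
  face_dim : forall f, exists2 m, (m < n)%N & has_dim (face_complex f) m;
  face_of_prototile : forall f, exists t, f \in faces t;
  face_subcomplex : forall t f, f \in faces t ->
    subcomplex_inclusion (@face_incl t f);
  face_incl_inj : forall t f g, f \in faces t -> g \in faces t ->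
    range (@face_incl t f) = range (@face_incl t g) -> f = g;
  opp_faceK : involutive opp_face
}.

Definition max_faces (R : realType) (n : nat) (P : prototiles R n) : nat :=
  \max_(t : prototile P) #|faces t|.

(* The isometry a_l : t_l -> t'_l is the restriction of [tile_map l] to
   [tile l]; the values of [tile_map l] outside of [tile l] are irrelevant. *)
Record tile_family (R : realType) (n : nat) (P : prototiles R n)
    (X : metricType R) := TileFamily {
  tile_index : Type;
  tile : tile_index -> set X;
  tile_type : tile_index -> prototile P;
  tile_map : forall l, X -> tile_complex (tile_type l)
}.

Section TileFamily.
Variables (R : realType) (n : nat) (P : prototiles R n) (X : metricType R).
Variable A : tile_family P X.
Implicit Types (l m : tile_index A) (f : face P).

(* The value of [tile_map l] in the disjoint union of the prototiles, so that
   maps to prototiles can be compared. *)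
Definition tile_val l (x : X) : {t : prototile P & tile_complex t} :=
  existT (fun t => mc_space (tile_complex t)) (tile_type l) (tile_map l x).

Definition tile_face l f : set X :=
  tile l `&` [set x | range (@face_incl _ _ P (tile_type l) f) (tile_map l x)].

Definition meet_along l m f : Prop :=
  [/\ l <> m,
      f \in faces (tile_type l) /\ opp_face f \in faces (tile_type m),
      tile l `&` tile m = tile_face l f &
      tile l `&` tile m = tile_face m (opp_face f)].

Definition tile_adjacent l m : Prop := exists f, meet_along l m f.

(* The set of tiles at distance at most r from l in the graph of A. *)
Fixpoint tile_ball l (r : nat) : set (tile_index A) :=
  if r is r'.+1 then
    tile_ball l r' `|` [set m | exists2 k, tile_ball l r' k & tile_adjacent k m]
  else [set l].

Definition patch l (r : nat) : set X := \bigcup_(m in tile_ball l r) tile m.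

(* The last two fields are the standing assumptions on the graph of A. *)
Record tiling_axioms : Prop := TilingAxioms {
  tile_inj : injective (@tile _ _ _ _ A);
  tile_map_isometry : forall l, isometry_on (tile l) (@tile_map _ _ _ _ A l);
  tile_map_onto : forall l, @tile_map _ _ _ _ A l @` tile l = setT;
  tile_cover : \bigcup_l @tile _ _ _ _ A l = setT;
  tile_interior : forall l,
    tile l `\` \bigcup_(f in [set f | f \in faces (tile_type l)]) tile_face l f
      = (tile l)°;
  tile_meet : forall l m,
    (tile l `|` tile m)° <> (tile l)° `|` (tile m)° -> tile_adjacent l m;
  tile_no_free_face : forall l f, f \in faces (tile_type l) ->
    exists m, meet_along l m f;
  tile_graph_connected : forall l m, exists r, tile_ball l r m;
  tile_graph_degree : forall l,
    ([set m | tile_adjacent l m] #<= `I_(max_faces P))%card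
}.

End TileFamily.

Record tiling (R : realType) (n : nat) (P : prototiles R n)
    (X : metricType R) := Tiling {
  tiling_family :> tile_family P X;
  tilingP : tiling_axioms tiling_family
}.

Section Tilings.
Variables (R : realType) (n : nat) (P : prototiles R n).

Definition carries_tile (X Y : metricType R) (A : tiling P X) (B : tiling P Y)
    (h : X -> Y) (l : tile_index A) (m : tile_index B) : Prop :=
  h @` tile l = tile m /\
  forall x, tile l x -> tile_val m (h x) = tile_val l x.

Definition patch_isomorphic (X Y : metricType R) (A : tiling P X)
    (B : tiling P Y) (t : tile_index A) (s : tile_index B) (r : nat) : Prop :=
  exists (h : X -> Y) (phi : tile_index A -> tile_index B),
    [/\ isometry_on (patch t r) h,
        h @` patch t r = patch s r,
        h @` tile t = tile s,
        set_bij (tile_ball t r) (tile_ball s r) phi &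
        forall l, tile_ball t r l -> carries_tile h l (phi l)].

Definition is_limit (X Y : metricType R) (A : tiling P X) (B : tiling P Y)
    (s : tile_index B) : Prop :=
  forall r, exists t : tile_index A, patch_isomorphic t s r.

Definition aperiodic (Y : metricType R) (B : tiling P Y) : Prop :=
  forall h : Y -> Y, isometry_on setT h -> bijective h ->
    (exists2 phi : tile_index B -> tile_index B,
       bijective phi & forall m, carries_tile h m (phi m)) ->
    h = id.

Definition limit_aperiodic (X : metricType R) (A : tiling P X) : Prop :=
  forall (Y : metricType R) (B : tiling P Y) (s : tile_index B),
    is_limit A s -> aperiodic B.

Definition repetitive (X : metricType R) (A : tiling P X) : Prop :=
  exists t0 : tile_index A, forall r0, exists2 r, (r0 <= r)%N &
    exists d, forall l : tile_index A, exists2 t : tile_index A,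
      tile_ball l d t & patch_isomorphic t t0 r.

End Tilings.

(* Main.v *)
Require Import Defs.
From HB Require Import structures.
From mathcomp Require Import all_boot all_order all_algebra.
From mathcomp Require Import finmap.
From mathcomp Require Import all_classical all_reals all_analysis.
From mathcomp Require Import ring lra zify.

Set Implicit Arguments.
Unset Strict Implicit.
Unset Printing Implicit Defensive.

Import Order.TTheory GRing.Theory Num.Theory.

(** Colour the tiles of a tiling by a finite set [C] and record the colour of a
    tile in its type: this is a tiling of the same space by the prototiles
    [prototile P * C], with the same graph. Everything therefore rests on a
    good colouring of the graph of tiles with [2 * D * (D - 1)] colours, where
    [D := max_faces P] bounds the degrees.

    A symmetry of a limit that moves a tile [u] to a tile [v] at distance [d]
    restricts to isomorphisms of balls of all radii, and copies of these balls
    occur in the original tiling. So it is enough that the colouring is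
    [separated]: for every [d] there is a radius [rad d] such that no two
    distinct tiles at distance at most [d] have isomorphic coloured balls of
    radius [rad d]. This property passes to limits ([separated_limit]) and
    forces a symmetry to fix every tile, hence every point, because a tile is
    isometric to its prototile ([separated_aperiodic]).

    The colour of a tile is a pair [(a, b)].

    The part [a] takes [D * (D - 1)] values and is rigid: any two neighbours of
    a tile have different values. Every vertex has at most [D * (D - 1)]
    vertices at two steps from it. Finite sets of vertices are coloured
    greedily, and since the graph is infinite the order can be chosen so that
    each vertex still has an uncoloured vertex at two steps when its turn
    comes, which saves the last colour ([rigid_coloring]). An [a]-preserving
    morphism of a ball is determined by the image of the centre
    ([rigid_unique]), and it has no fixed point if it moves the centre
    ([rigid_fixpoint]).

    The part [b] takes two values. For each pair [(u, v)] there is only one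
    morphism [f] to spoil, and at least a third of the ball around [u] forms
    a set [T] disjoint from its image ([displaced_subset]); the bad event is
    that [b (f x) = b x] for all [x] in [T]. All these events are avoided together
    by a counting argument in the style of Rosenfeld ([bicoloring]): if for
    every vertex the sum of [(2 / 3) ^ #|T|] over the events that involve it is
    at most [1 / 3], then each new vertex multiplies the number of good
    colourings of a finite set by at least [3 / 2]. The sum is small as soon as
    [#|T|] dominates the logarithm of the number of events through a vertex,
    that is, as soon as the ball around [u] is not exponentially smaller than a
    ball of eight times its radius; for large [r], one of the radii [r] and
    [8 * r] has this property, because balls grow at least linearly and at most
    exponentially ([good_radii]).

    For the second part of the theorem, consider sets of coloured patterns
    around a tile [t0] whose patches recur with bounded gaps, and take such a
    set [F] maximal for the property that some separated colouring has no
    pattern of [F] anywhere. Such a colouring [c] is repetitive: if one of the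
    patterns of [c] around [t0] were missing from arbitrarily large regions,
    these regions contain copies of larger and larger patches around [t0], and
    a limit of the colourings transported to [t0] would be a separated
    colouring without the patterns of [F] and without that pattern
    ([repetitive_coloring]). Limits of colourings come from ultrafilters
    ([coloring_cluster]). *)

(** * Compactness of the space of colourings *)

(** An ultrafilter containing [F] decides the colour of each vertex; finitely
    many such decisions and a member of [F] have a common witness. *)
Lemma coloring_cluster (J V : Type) (C : finType) (F : set_system J)
    (c : J -> V -> C) :
  ProperFilter F ->
  exists c' : V -> C, forall (S : set V) (A : set J), finite_set S -> F A ->
    exists2 j, A j & forall x, S x -> c j x = c' x.
Proof.
move=> FF; have [U [UU FU]] := ultraFilterLemma FF.
have ex x : exists i, U [set j | c j x = i]%classic.
  apply: contrapT => /forallNP nU.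
  have /filter_ex[j] : U [set j | forall i, ~ (c j x = i)]%classic.
    apply: (@filter_forall _ _ (fun i => [set j | c j x <> i]%classic)) => i.
    by have [/nU|] := in_ultra_setVsetC [set j | c j x = i]%classic UU.
  by move=> /(_ (c j x)).
have [c' c'P] := choice ex.
exists c' => S A finS FA.
have finS' : finite_set (S : set {classic V}) by [].
have US : U [set j | forall x, S x -> c j x = c' x]%classic.
  apply: filterS (@filter_bigI J {classic V} (fset_set (S : set {classic V}))
    (fun x => [set j | c j x = c' x]%classic) U _ (fun i _ => c'P i)) => j /= Sj x Sx.
  by apply: Sj; rewrite /= in_fset_set// inE.
have /filter_ex[j []] : U (A `&` [set j | forall x, S x -> c j x = c' x])%classic.
  exact: filterI (FU _ FA) US.
by exists j.
Qed.

(** * Two-colourings that avoid sparse events *)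

Section Counting.
Local Open Scope ring_scope.
Variables (R : realFieldType) (V E : finType) (T : E -> {set V}) (f : E -> V -> V).

Definition event_support e := T e :|: f e @: T e.

(** The subset [X] is the two-colouring by its indicator function. An event with
    empty [T e] counts as impossible, so that a family of events can be padded
    with such dummies. *)
Definition monochromatic e (X : {set V}) :=
  (T e != finset.set0) && [forall x in T e, (x \in X) == (f e x \in X)].
Definition good_sets (S : {set V}) :=
  [set X : {set V} | X \subset S &
    [forall e, (event_support e \subset S) ==> ~~ monochromatic e X]].

Hypothesis finj : forall e, {in T e &, injective (f e)}.
Hypothesis fT : forall e, [disjoint T e & f e @: T e].
Hypothesis sparse : forall w,
  \sum_(e | w \in event_support e) (2 / 3) ^+ #|T e| <= 1 / 3 :> R.

Lemma monochromatic_eq e (X Y : {set V}) :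
  {in event_support e, X =i Y} -> monochromatic e X = monochromatic e Y.
Proof.
move=> XY; congr (_ && _); apply: eq_forallb_in => x xT.
by rewrite !XY // !inE ?imset_f ?xT ?orbT.
Qed.

Lemma good_setsI (S S' X : {set V}) : S' \subset S -> X \in good_sets S ->
  X :&: S' \in good_sets S'.
Proof.
move=> sS; rewrite !inE => /andP[_ /forallP Xgood]; rewrite subsetIr /=.
apply/forallP => e; apply/implyP => eS'.
rewrite (@monochromatic_eq _ _ X).
  exact: (implyP (Xgood e) (fintype.subset_trans eS' sS)).
by move=> x /(fintype.subsetP eS') xS'; rewrite inE xS' andbT.
Qed.

(** Once [w] is involved in a bad event, the colours on [T e] are dictated by
    those on [f e @: T e] and conversely. Forget the colours on whichever of
    the two contains [w]: the colouring that remains is good on a set with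
    [#|T e| - 1] points of [S] removed and determines the original one. *)
Lemma card_monochromatic e (w : V) (S : {set V}) : w \in event_support e ->
  w \notin S -> event_support e \subset w |: S ->
  exists2 D : {set V}, (D \subset S) && (#|D|.+1 == #|T e|) &
  (#|[set Y : {set V} | [&& Y \subset w |: S, Y :&: S \in good_sets S &
      monochromatic e Y]]| <= #|good_sets (S :\: D)|)%N.
Proof.
move=> we wS eS.
have main (U : {set V}) : w \in U -> U \subset w |: S -> #|U| = #|T e| ->
    (forall x, x \in U -> exists2 y, y \notin U &
        forall X, monochromatic e X -> (x \in X) = (y \in X)) ->
  exists2 D : {set V}, (D \subset S) && (#|D|.+1 == #|T e|) &
  (#|[set Y : {set V} | [&& Y \subset w |: S, Y :&: S \in good_sets S &
      monochromatic e Y]]| <= #|good_sets (S :\: D)|)%N.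
  move=> wU US cU partner; exists (U :\ w).
    by rewrite -cU [X in _ == X](cardsD1 w) wU add1n eqxx andbT subDset.
  have SD : S :\: (U :\ w) = (w |: S) :\: U.
    apply/setP => x; rewrite !inE; have [->|//] := eqVneq x w.
    by rewrite wU (negPf wS).
  rewrite SD; set B := [set _ | _].
  (* A forgotten colour is read off at the partner, outside of [U]. *)
  have Dinj : {in B &, injective (fun Y => Y :\: U)}.
    move=> Y Z; rewrite !inE => /and3P[_ _ mY] /and3P[_ _ mZ] YZ.
    apply/setP => x; have [xU|xU] := boolP (x \in U); last first.
      by move/setP: YZ => /(_ x); rewrite !inE xU.
    have [y yU xy] := partner _ xU; rewrite (xy Y) // (xy Z) //.
    by move/setP: YZ => /(_ y); rewrite !inE yU.
  rewrite -(card_in_imset Dinj); apply: subset_leq_card.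
  apply/fintype.subsetP => _ /imsetP[Y + ->]; rewrite inE => /and3P[YS YG _].
  have sub : (w |: S) :\: U \subset S by rewrite -SD subsetDl.
  have -> : Y :\: U = (Y :&: S) :&: ((w |: S) :\: U).
    apply/setP => x; rewrite -SD !inE; have [->|xw] /= := eqVneq x w.
      by rewrite wU (negPf wS) !andbF.
    have [xY|] /= := boolP (x \in Y); last by rewrite andbF.
    by have := fintype.subsetP YS x xY; rewrite !inE (negPf xw) /= => ->; rewrite !andbT.
  exact: good_setsI YG.
have monoP X x : monochromatic e X -> x \in T e -> (x \in X) = (f e x \in X).
  by move=> /andP[_ /forallP/(_ x)/implyP] + xT => /(_ xT)/eqP.
have [sT sf] : T e \subset w |: S /\ f e @: T e \subset w |: S.
  by move: eS; rewrite finset.subUset => /andP.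
move: we; rewrite inE => /orP[wT|wf].
- apply: (main (T e)) => // x xT; exists (f e x) => [|X mX]; last exact: monoP.
  by have /disjointFl -> := fT e => //; exact: imset_f.
- apply: (main (f e @: T e)) => //; first exact: card_in_imset.
  move=> _ /imsetP[x xT ->]; exists x => [|X mX]; last by rewrite -(monoP _ _ mX xT).
  by have /disjointFr -> := fT e.
Qed.

(** The hypothesis is the induction hypothesis of [card_good_setsU1]. *)
Lemma card_good_setsD (n : nat) :
  (forall (S : {set V}) (w : V), (#|S| < n)%N -> w \notin S ->
     3 / 2 * #|good_sets S|%:R <= #|good_sets (w |: S)|%:R :> R) ->
  forall S D : {set V}, (#|S| <= n)%N -> D \subset S ->
    #|good_sets (S :\: D)|%:R <= (2 / 3) ^+ #|D| * #|good_sets S|%:R :> R.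
Proof.
move=> grow S D; move: {2}#|D| (erefl #|D|) => k; elim: k S D => [|k IH] S D.
  by move/eqP; rewrite cards_eq0 => /eqP -> _ _; rewrite finset.setD0 cards0 mul1r.
move=> cD Sn DS; have [d dD] : exists d, d \in D by apply/card_gt0P; rewrite cD.
have dS := fintype.subsetP DS _ dD.
have cD' : #|D :\ d| = k by move: cD; rewrite (cardsD1 d) dD add1n => -[].
have cS : (#|S :\ d| < n)%N by move: Sn; rewrite (cardsD1 d) dS add1n.
have -> : S :\: D = (S :\ d) :\: (D :\ d).
  by apply/setP => x; rewrite !inE; have [->|] := eqVneq x d; rewrite ?dD ?andbF.
have := IH (S :\ d) (D :\ d) cD' (ltnW cS) (finset.setSD _ DS).
move=> /le_trans; apply; rewrite cD' cD exprSr -mulrA.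
apply: ler_wpM2l; first by rewrite exprn_ge0 // divr_ge0.
have := grow (S :\ d) d cS; rewrite !inE eqxx => /(_ isT).
by rewrite finset.setD1K // => h; lra.
Qed.

(** Of the [2 * #|good_sets S|] ways to extend a good colouring of [S] to [w],
    those that fail are lost to an event through [w], and the hypothesis
    [sparse] bounds the total loss by half of [#|good_sets S|]. *)
Lemma card_good_setsU1 (S : {set V}) w : w \notin S ->
  3 / 2 * #|good_sets S|%:R <= #|good_sets (w |: S)|%:R :> R.
Proof.
have [n] := ubnP #|S|; elim: n S w => // n IH S w Sn wS.
(* [H] gathers all the extensions, good or not. *)
pose H := [set Y : {set V} | (Y \subset w |: S) && (Y :&: S \in good_sets S)].
have cH : #|H| = (#|good_sets S| + #|good_sets S|)%N.
  have HI : H = good_sets S :|: [set w |: X | X in good_sets S].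
    apply/setP => Y; rewrite [in RHS]inE [in LHS]inE.
    apply/andP/orP => [[YS YG]|[YG|/imsetP[X XG ->]]].
    - have [wY|wY] := boolP (w \in Y); [right|left].
        apply/imsetP; exists (Y :&: S) => //; apply/setP => x; rewrite !inE.
        have [->|xw] /= := eqVneq x w; first by rewrite wY.
        have [xY|//] /= := boolP (x \in Y).
        by have := fintype.subsetP YS x xY; rewrite !inE (negPf xw).
      suff <- : Y :&: S = Y by [].
      apply/finset.setIidPl/fintype.subsetP => x xY; have := fintype.subsetP YS x xY.
      by rewrite !inE; case/orP => // /eqP xw; rewrite -xw xY in wY.
    - have YS : Y \subset S by move: YG; rewrite inE => /andP[].
      by rewrite (finset.setIidPl YS) YG (fintype.subset_trans YS (finset.subsetUr _ _)).
    - have XS : X \subset S by move: XG; rewrite inE => /andP[].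
      rewrite finset.setUS //; split => //.
      suff -> : (w |: X) :&: S = X by [].
      apply/setP => x; rewrite !inE; have [->|_] /= := eqVneq x w.
        by rewrite (negPf wS); apply/esym/negbTE; apply: contra wS => /(fintype.subsetP XS).
      by apply/andP/idP => [[]|xX] //; split => //; exact: (fintype.subsetP XS).
  rewrite HI cardsU (_ : _ :&: _ = finset.set0) ?cards0 ?subn0.
    congr (_ + _)%N; apply: card_in_imset => X Y.
    rewrite !inE => /andP[XS _] /andP[YS _] /setP XY.
    apply/setP => x; have := XY x; rewrite !inE; have [->|//] := eqVneq x w.
    move=> _; apply/idP/idP => [/(fintype.subsetP XS)|/(fintype.subsetP YS)];
      by rewrite (negPf wS).
  apply/eqP; rewrite -finset.subset0; apply/fintype.subsetP => Y; rewrite inE => /andP[].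
  rewrite inE => /andP[YS _] /imsetP[X _ YX]; move: wS.
  by rewrite (fintype.subsetP YS) // YX !inE eqxx.
pose B e := [set Y : {set V} | [&& Y \subset w |: S, Y :&: S \in good_sets S &
      monochromatic e Y]].
pose P e := (w \in event_support e) && (event_support e \subset w |: S).
have HG : (#|H| <= #|good_sets (w |: S)| + \sum_(e | P e) #|B e|)%N.
  have sub : H \subset good_sets (w |: S) :|: \bigcup_(e | P e) B e.
    apply/fintype.subsetP => Y; rewrite inE => /andP[YS YG]; rewrite finset.in_setU.
    have [//|] := boolP (Y \in good_sets (w |: S)).
    rewrite inE YS /= negb_forall => /existsP[e].
    rewrite negb_imply negbK => /andP[eS mY].
    apply/finset.bigcupP; exists e; last by rewrite inE YS YG.
    rewrite /P eS andbT; apply: contraT => we; move: YG.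
    rewrite inE => /andP[_ /forallP/(_ e)].
    have eS' : event_support e \subset S.
      apply/fintype.subsetP => x xe; have := fintype.subsetP eS x xe; rewrite !inE.
      by case/orP => // /eqP xw; rewrite -xw xe in we.
    rewrite eS' /= (@monochromatic_eq _ _ Y) ?mY //.
    by move=> x /(fintype.subsetP eS') xS; rewrite inE xS andbT.
  apply: leq_trans (subset_leq_card sub) _.
  apply: leq_trans (leq_card_setU _ _) _; rewrite leq_add2l.
  apply: (big_ind2 (fun (X : {set {set V}}) k => (#|X| <= k)%N)) => //.
    by rewrite cards0.
  by move=> X k X' k' Xk Xk'; rewrite (leq_trans (leq_card_setU _ _)) // leq_add.
have Be e : P e ->
    #|B e|%:R <= 3 / 2 * #|good_sets S|%:R * (2 / 3) ^+ #|T e| :> R.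
  move=> /andP[we eS].
  have [D /andP[DS /eqP cD] BD] := card_monochromatic we wS eS.
  rewrite (le_trans (y := #|good_sets (S :\: D)|%:R)) ?ler_nat //.
  apply: le_trans (@card_good_setsD n IH S D _ DS) _; first by rewrite -ltnS.
  rewrite -cD exprS; set x := _ ^+ _; set y := _%:R.
  by rewrite le_eqVlt; apply/orP; left; apply/eqP; field.
have : #|H|%:R <= #|good_sets (w |: S)|%:R + \sum_(e | P e) #|B e|%:R :> R.
  by rewrite -natr_sum -natrD ler_nat.
have sumB : \sum_(e | P e) #|B e|%:R <= 1 / 2 * #|good_sets S|%:R :> R.
  apply: le_trans (ler_sum _ Be) _; rewrite -mulr_sumr.
  have : \sum_(e | P e) (2 / 3) ^+ #|T e| <= 1 / 3 :> R.
    apply: le_trans (sparse w).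
    rewrite [leRHS](bigID (fun e => event_support e \subset w |: S)) /= lerDl.
    by apply: sumr_ge0 => e _; rewrite exprn_ge0 // divr_ge0.
  have : (0 : R) <= #|good_sets S|%:R by [].
  set x := \sum_(e | _) _; set y := _%:R; nra.
by rewrite cH natrD; lra.
Qed.

Lemma bicoloring : exists X : {set V}, forall e, ~~ monochromatic e X.
Proof.
have /card_gt0P[X] : (0 < #|good_sets finset.setT|)%N.
  have := @card_good_setsD #|V|.+1 (fun S w _ => @card_good_setsU1 S w)
    finset.setT finset.setT.
  rewrite cardsT leqnSn finset.setDv => /(_ isT (subxx _)).
  rewrite lt0n; apply: contraTneq => ->; rewrite mulr0 lern0 -lt0n.
  apply/card_gt0P; exists finset.set0; rewrite inE finset.sub0set; apply/forallP => e.
  rewrite finset.subset0; apply/implyP => /eqP e0.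
  apply/negP => /andP[/set0Pn[x xT] _].
  have : x \in event_support e by rewrite inE xT.
  by rewrite e0 inE.
rewrite inE => /andP[_ /forallP XG]; exists X => e; have := XG e.
by rewrite finset.subsetT.
Qed.
End Counting.

(** The constraint attached to [F] is meant to grow with [F]; a colouring obeying
    all constraints arises as a limit along the directed set of the [F]. *)
Lemma coloring_compactness (V : choiceType) (C : finType) (I : choiceType)
    (P : {fset I} -> (V -> C) -> Prop) :
  (forall F, exists c, P F c) ->
  exists c', forall (S : {fset V}) (F : {fset I}), exists F' c,
    [/\ (F `<=` F')%fset, P F' c & forall x, x \in S -> c x = c' x].
Proof.
move=> /choice[c cP].
pose G : set_system {fset I} :=
  filter_from setT (fun F => [set F' | (F `<=` F')%fset]%classic).
have GG : ProperFilter G.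
  apply: filter_from_proper => [|F _]; last by exists F => /=.
  apply: filter_from_filter; first by exists fset0.
  move=> F F' _ _; exists (F `|` F')%fset => //= F''/= FF'.
  by split => /=; apply: fsubset_trans FF'; rewrite (fsubsetUl, fsubsetUr).
have [c' c'P] := coloring_cluster c GG.
exists c' => S F.
have [//||F' FF' eqc] := c'P [set` S]%classic [set F' | (F `<=` F')%fset]%classic.
  by exists F.
by exists F', (c F'); split => // x xS; exact: eqc.
Qed.

Section InfiniteBicoloring.
Local Open Scope ring_scope.
Variables (R : realFieldType) (V I : choiceType) (T : I -> {fset V}).
Variable f : I -> V -> V.
Hypothesis finj : forall i, {in T i &, injective (f i)}.
Hypothesis fT : forall i x, x \in T i -> f i x \notin T i.
Hypothesis sparse : forall (F : {fset I}) w,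
  \sum_(i <- F | w \in (T i `|` f i @` T i)%fset) (2 / 3) ^+ #|` T i|
    <= 1 / 3 :> R.

(** Finitely many events live on a finite set, where [bicoloring] applies;
    compactness does the rest. *)
Lemma infinite_bicoloring : exists b : V -> bool, forall i, T i != fset0 ->
  exists2 x, x \in T i & b x != b (f i x).
Proof.
have [|b bP] := @coloring_compactness V bool I (fun F b => forall i, i \in F ->
    T i != fset0 -> exists2 x, x \in T i & b x != b (f i x)).
  move=> F; pose W := (\bigcup_(i <- F) (T i `|` f i @` T i))%fset.
  have TW (i : F) : (T (val i) `|` f (val i) @` T (val i) `<=` W)%fset.
    by apply: bigfcup_sup; rewrite ?(fsvalP i).
  pose T' (i : F) : {set W} := fsub W (T (val i)).
  pose f' (i : F) (x : W) : W := insubd x (f (val i) (val x)).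
  have T'E i x : (x \in T' i) = (val x \in T (val i)) by rewrite in_fsub.
  have f'E i x : x \in T' i -> val (f' i x) = f (val i) (val x).
    rewrite T'E => xT; rewrite /f' /insubd insubT //=.
    by apply: (fsubsetP (TW i)); rewrite inE in_imfset ?orbT.
  have [||w|X Xgood] := @bicoloring R W F T' f'.
  - move=> i x y xT yT /(congr1 val); rewrite !f'E // => fxy; apply: val_inj.
    by apply: finj fxy; rewrite -T'E.
  - move=> i; rewrite disjoint_subset; apply/fintype.subsetP => x xT.
    rewrite inE; apply/negP => /imsetP[y yT xy].
    move: xT; rewrite T'E xy f'E //; apply/negP/fT.
    by rewrite -T'E.
  - apply: le_trans (sparse F (val w)); rewrite big_seq_fsetE /=.
    rewrite le_eqVlt; apply/orP; left; apply/eqP; apply: eq_big => i; last first.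
      by rewrite card_fsub // (fsubset_trans _ (TW i)) // fsubsetUl.
    rewrite finset.in_setU in_fsetU T'E; congr (_ || _); apply/imsetP/imfsetP => /= -[x xT wx].
      by exists (val x); rewrite ?wx ?f'E // -T'E.
    have xW : x \in W by apply: (fsubsetP (TW i)); rewrite inE xT.
    exists [` xW]%fset; first by rewrite T'E.
    by apply: val_inj; rewrite f'E // T'E.
  exists (fun x => if insub x is Some x' then x' \in X else false) => i iF Ti.
  have := Xgood [` iF]%fset; rewrite negb_and negbK => /orP[|].
    by rewrite fsub_eq0 ?(negPf Ti) // (fsubset_trans _ (TW [` iF]%fset)) // fsubsetUl.
  rewrite negb_forall => /existsP[x]; rewrite negb_imply => /andP[xT xf].
  exists (val x); first by rewrite T'E in xT.
  have -> : f i (val x) = val (f' [` iF]%fset x) by rewrite f'E.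
  by rewrite !valK.
exists b => i Ti.
have [F' [c [iF' cP cb]]] := bP (T i `|` f i @` T i)%fset [fset i]%fset.
have [|x xT bx] := cP i _ Ti; first by apply: (fsubsetP iF'); rewrite inE.
by exists x => //; rewrite -!cb // inE ?xT // in_imfset ?orbT.
Qed.

End InfiniteBicoloring.

(** * Balls in a graph and their morphisms *)

Fixpoint graph_ball (V : Type) (e : V -> V -> Prop) x r : set V :=
  if r is r'.+1 then
    (graph_ball e x r' `|` [set y | exists2 z, graph_ball e x r' z & e z y])%classic
  else [set x]%classic.

Section Balls.
Variables (V : Type) (e : V -> V -> Prop).

Lemma graph_ball_center x r : graph_ball e x r x.
Proof. by elim: r => // r; left. Qed.

Lemma graph_ball_edge x r y z : graph_ball e x r y -> e y z -> graph_ball e x r.+1 z.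
Proof. by move=> xy yz; right; exists y. Qed.

Lemma graph_ball_mono x r r' y : (r <= r')%N -> graph_ball e x r y -> graph_ball e x r' y.
Proof.
move=> /subnKC <-; elim: (r' - r)%N => [|k IH]; first by rewrite addn0.
by move=> xy; rewrite addnS; left; exact: IH.
Qed.

Lemma graph_ball_trans x y z r s :
  graph_ball e x r y -> graph_ball e y s z -> graph_ball e x (r + s) z.
Proof.
move=> xy; elim: s z => [|s IH] z; first by rewrite addn0 => ->.
rewrite addnS => -[/IH|[w /IH xw wz]]; first by left.
exact: graph_ball_edge xw wz.
Qed.

Hypothesis esym : forall x y, e x y -> e y x.

Lemma graph_ball_sym x y r : graph_ball e x r y -> graph_ball e y r x.
Proof.
elim: r y => [|r IH] y; first by move=> ->.
move=> [/IH|[z /IH zx zy]]; first by left.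
rewrite -add1n; apply: graph_ball_trans zx.
by apply: (graph_ball_edge (r := 0)) (esym zy).
Qed.

End Balls.

Section PartialMorphisms.
Variables (V : Type) (e : V -> V -> Prop) (C : Type).

(** The weakest notion of isomorphism that the argument can do with, since it
    has to be excluded: only edges inside the ball matter and non-edges may be
    sent to edges. *)
Record ball_morphism (c : V -> C) r u v (f : V -> V) : Prop := BallMorphism {
  morph_center : f u = v;
  morph_inj : forall x y, graph_ball e u r x -> graph_ball e u r y -> f x = f y -> x = y;
  morph_edge : forall x y, graph_ball e u r x -> graph_ball e u r y -> e x y ->
    e (f x) (f y);
  morph_color : forall x, graph_ball e u r x -> c (f x) = c x
}.

Lemma ball_morphism_le c r r' u v f : (r <= r')%N ->
  ball_morphism c r' u v f -> ball_morphism c r u v f.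
Proof.
by move=> rr' [fu fi fe fc]; split => // [x y ux uy|x y ux uy|x ux];
  [apply: fi|apply: fe|apply: fc]; apply: graph_ball_mono rr' _.
Qed.

Lemma ball_morphism_ball c r u v f s x : ball_morphism c r u v f ->
  (s <= r)%N -> graph_ball e u s x -> graph_ball e v s (f x).
Proof.
move=> fm; elim: s x => [|s IH] x sr; first by move=> ->; rewrite (morph_center fm).
move=> [ux|[y uy yx]]; first by left; apply: IH => //; exact: ltnW.
apply: (graph_ball_edge (y := f y)); first by apply: IH => //; exact: ltnW.
apply: (morph_edge fm) => //; first by apply: graph_ball_mono uy; exact: ltnW.
by apply: graph_ball_mono sr _; exact: graph_ball_edge uy yx.
Qed.

Variable a : V -> C.
Hypothesis esym : forall x y, e x y -> e y x.
Hypothesis arigid : forall x y z, e z x -> e z y -> a x = a y -> x = y.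

(** Two morphisms that agree at a vertex agree at its neighbours, which the
    colours tell apart. *)
Lemma rigid_unique r u v f g x :
  ball_morphism a r u v f -> ball_morphism a r u v g -> graph_ball e u r x ->
  f x = g x.
Proof.
move=> fm gm; suff H s y : (s <= r)%N -> graph_ball e u s y -> f y = g y by exact: H.
elim: s y => [|s IH] y sr; first by move=> ->; rewrite (morph_center fm) (morph_center gm).
move=> [uy|[z uz zy]]; first by apply: IH => //; exact: ltnW.
have fgz : f z = g z by apply: IH => //; exact: ltnW.
have uz' : graph_ball e u r z by apply: graph_ball_mono uz; exact: ltnW.
have uy' : graph_ball e u r y by apply: graph_ball_mono sr _; exact: graph_ball_edge uz zy.
apply: (@arigid _ _ (f z)); first exact: (morph_edge fm).
- by rewrite fgz; exact: (morph_edge gm).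
- by rewrite (morph_color fm) // (morph_color gm).
Qed.

(** Being fixed propagates along a path from [x] back to the centre. *)
Lemma rigid_fixpoint r u v f x :
  ball_morphism a r u v f -> graph_ball e u r x -> f x = x -> u = v.
Proof.
move=> fm; suff H s y : (s <= r)%N -> graph_ball e u s y -> f y = y -> u = v by exact: H.
elim: s y => [|s IH] y sr; first by move=> ->; rewrite (morph_center fm).
move=> [uy|[z uz zy]] fy; first by apply: (IH y) => //; exact: ltnW.
have uz' : graph_ball e u r z by apply: graph_ball_mono uz; exact: ltnW.
have uy' : graph_ball e u r y by apply: graph_ball_mono sr _; exact: graph_ball_edge uz zy.
apply: (IH z) => //; first exact: ltnW.
apply: (@arigid _ _ y); last exact: (morph_color fm).
- by rewrite -{1}fy; apply: (morph_edge fm) => //; exact: esym.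
- exact: esym.
Qed.

End PartialMorphisms.

(** * Growth of balls and rigid colourings *)

Section LocallyFinite.
Variables (V : choiceType) (e : V -> V -> Prop) (D : nat).
Hypothesis esym : forall x y, e x y -> e y x.
Hypothesis edeg : forall x, ([set y | e x y] #<= `I_D)%card.
Hypothesis econn : forall x y, exists r, graph_ball e x r y.
Hypothesis Vinf : infinite_set [set: V]%classic.

Let nbhd x : {fset V} := fset_set [set y | e x y]%classic.

Let in_nbhd x y : (y \in nbhd x) = `[< e x y >].
Proof.
rewrite in_fset_set; first by apply/idP/asboolP; rewrite inE.
by apply/finite_set_leP; exists D.
Qed.

Let nbhdP x y : reflect (e x y) (y \in nbhd x).
Proof. by rewrite in_nbhd; apply: asboolP. Qed.

Let card_nbhd x : (#|` nbhd x| <= D)%N.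
Proof. exact: geq_card_fset_set. Qed.

Let inf_fset (S : {fset V}) : exists x, x \notin S.
Proof.
apply: contrapT => /forallNP nS; apply: Vinf.
apply: (sub_finite_set (B := [set` S]%classic)) => // x _ /=.
by apply: contrapT => /negP /nS.
Qed.

Let connected_closed (S : {fset V}) x : x \in S ->
  exists y z, [/\ y \in S, z \notin S & e y z].
Proof.
move=> xS; apply: contrapT => nS; have [w wS] := inf_fset S.
have [r] := econn x w; move/negP: wS; apply: contra_not.
elim: r w => [|r IH] w; first by move=> ->.
move=> [/IH//|[y /IH yS yw]]; apply: contrapT => /negP wS.
by apply: nS; exists y, w.
Qed.

Lemma graph_ball_finite x r : finite_set (graph_ball e x r).
Proof.
elim: r => [|r IH]; first exact: finite_set1.
rewrite /= finite_setU; split => //.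
apply: (sub_finite_set (B := (\bigcup_(z in graph_ball e x r) [set y | e z y])%classic)).
  by move=> y [z xz zy]; exists z.
apply: bigcup_finite => // z _.
by apply/finite_set_leP; exists D.
Qed.

Definition graph_fball x r : {fset V} := fset_set (graph_ball e x r).

Lemma graph_fballP x r y : reflect (graph_ball e x r y) (y \in graph_fball x r).
Proof.
by rewrite in_fset_set; [apply: (iffP idP); rewrite inE|exact: graph_ball_finite].
Qed.

Let card_bigfcup (S : {fset V}) (F : V -> {fset V}) k :
  (forall z, z \in S -> #|` F z| <= k)%N ->
  (#|` (\bigcup_(z <- S) F z)%fset| <= #|` S| * k)%N.
Proof.
move=> Fk; apply: (@leq_trans (\sum_(z <- S) k)); last first.
  by rewrite big_const_seq iter_addn_0 count_predT mulnC.
rewrite big_seq [X in (_ <= X)%N]big_seq.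
apply: (big_ind2 (fun (X : {fset V}) k => (#|` X| <= k)%N)) => //.
move=> X i Y j Xi Yj; apply: leq_trans (leq_add Xi Yj).
by rewrite cardfsU leq_subr.
Qed.

Lemma card_graph_fball_le x r : (#|` graph_fball x r| <= 2 ^ (D * r))%N.
Proof.
apply: (@leq_trans (D.+1 ^ r)); last first.
  by rewrite expnM; case: r => // r; rewrite leq_exp2r // ltn_expl.
elim: r => [|r IH]; first by rewrite /graph_fball fset_set1 cardfs1.
rewrite expnSr mulnS.
apply: (@leq_trans #|` (graph_fball x r `|` \bigcup_(z <- graph_fball x r) nbhd z)%fset|).
  apply/fsubset_leq_card/fsubsetP => y /graph_fballP[/graph_fballP xy|[z /graph_fballP xz zy]].
    by rewrite inE xy.
  by rewrite inE; apply/orP; right; apply/bigfcupP; exists z; rewrite ?andbT //; exact/nbhdP.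
rewrite cardfsU (leq_trans (leq_subr _ _)) // leq_add //.
apply: leq_trans (card_bigfcup _) _; first by move=> z _; exact: card_nbhd.
by rewrite leq_mul2r IH orbT.
Qed.

Lemma card_graph_fball_gt x r : (r < #|` graph_fball x r|)%N.
Proof.
elim: r => [|r IH]; first by rewrite /graph_fball fset_set1 cardfs1.
apply: leq_ltn_trans IH _; apply: fproper_ltn_card.
have [|y [z [/graph_fballP xy xz yz]]] := @connected_closed (graph_fball x r) x.
  by apply/graph_fballP; exact: graph_ball_center.
rewrite fproperE; apply/andP; split.
  by apply/fsubsetP => w /graph_fballP xw; apply/graph_fballP; left.
apply/negP => /fsubsetP/(_ z); rewrite (negPf xz) => zS.
suff : false by []; apply: zS.
by apply/graph_fballP; exact: graph_ball_edge xy yz.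
Qed.

Lemma degree_gt1 : (1 < D)%N.
Proof.
have [x _] := inf_fset fset0.
have [|x' [y [+ + ]]] := @connected_closed [fset x]%fset x; first by rewrite inE.
rewrite !inE => /eqP -> yx xy.
have [|y' [z [+ + y'z]]] := @connected_closed [fset x; y]%fset x; first by rewrite !inE eqxx.
rewrite !inE negb_or => y'xy /andP[zx zy].
have card2 p q w : e w p -> e w q -> p != q -> (1 < D)%N.
  move=> wp wq pq; apply: leq_trans (card_nbhd w).
  suff : ([fset p; q] `<=` nbhd w)%fset by move=> /fsubset_leq_card; rewrite cardfs2 pq.
  by apply/fsubsetP => t; rewrite !inE => /orP[] /eqP ->; apply/nbhdP.
case/orP: y'xy => /eqP y'E; rewrite y'E in y'z.
- by apply: (card2 y z x xy y'z); rewrite eq_sym.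
- by apply: (card2 x z y (esym xy) y'z); rewrite eq_sym.
Qed.

(** The vertices that a rigid colouring must distinguish from [x]. *)
Let two_step x : {fset V} := (\bigcup_(z <- nbhd x) (nbhd z `\ x))%fset.

Let two_stepP x y : reflect (x <> y /\ exists2 z, e z x & e z y) (y \in two_step x).
Proof.
apply: (iffP (bigfcupP _ _ _ _)) => [[z /andP[/nbhdP xz _]]|[xy [z zx zy]]].
  by rewrite !inE => /andP[/eqP yx /nbhdP zy]; split; [exact/nesym|exists z => //; exact: esym].
exists z; first by rewrite andbT; apply/nbhdP/esym.
by rewrite !inE; apply/andP; split; [apply/eqP/nesym|exact/nbhdP].
Qed.

Let card_two_step x : (#|` two_step x| <= D * (D - 1))%N.
Proof.
apply: leq_trans (card_bigfcup (k := D - 1) _) _; last by rewrite leq_mul2r card_nbhd orbT.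
move=> z /nbhdP xz; rewrite leq_subRL; last exact: ltnW degree_gt1.
by apply: leq_trans (card_nbhd z); rewrite [leqRHS](cardfsD1 x) (introT (nbhdP _ _) (esym xz)).
Qed.

(** If [S] were closed under two steps, then [S] and its neighbours would form a
    finite set closed under one step, hence the whole graph. *)
Let two_step_exit (S : {fset V}) : S != fset0 -> exists x y, [/\ x \in S, y \in two_step x & y \notin S].
Proof.
move=> /fset0Pn[s sS]; apply: contrapT => nS.
have closed x y : x \in S -> y \in two_step x -> y \in S.
  by move=> xS xy; apply: contrapT => /negP yS; apply: nS; exists x, y.
pose W := (S `|` \bigcup_(x <- S) nbhd x)%fset.
have [|y [z [+ + yz]]] := @connected_closed W s; first by rewrite inE sS.
rewrite !inE => /orP[yS|yW] /norP[zS /negP zW]; apply: zW.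
  by apply/bigfcupP; exists y; rewrite ?yS //; exact/nbhdP.
case/bigfcupP: yW => x /andP[xS _] /nbhdP xy.
have [zx|/eqP zx] := eqVneq x z; first by rewrite -zx xS in zS.
have zS' : z \in S by apply: closed xS _; apply/two_stepP; split => //; exists y => //; exact: esym.
by rewrite zS' in zS.
Qed.

Local Notation q := (D * (D - 1))%N.

(** The vertex [x] coloured last has a vertex [y] at two steps outside [S], so at
    most [D * (D - 1) - 1] colours are taken. *)
Let rigid_finite (S : {fset V}) : exists c : V -> 'I_q,
  forall x y, x \in S -> y \in S -> y \in two_step x -> c x <> c y.
Proof.
have [n] := ubnP #|` S|; elim: n S => // n IH S Sn.
have [->|S0] := eqVneq S fset0.
  have q0 : (0 < q)%N by have D1 := degree_gt1; rewrite muln_gt0 subn_gt0 D1 ltnW.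
  by exists (fun=> Ordinal q0) => x y; rewrite inE.
have [x [y [xS xy yS]]] := two_step_exit S0.
have [|c cP] := IH (S `\ x)%fset; first by move: Sn; rewrite (cardfsD1 x) xS.
have [i iP] : exists i : 'I_q, i \notin [fset c z | z in (two_step x `\ y)%fset]%fset.
  apply: contrapT => /forallNP nI.
  have : ([fset i | i in 'I_q]%fset `<=` [fset c z | z in (two_step x `\ y)%fset])%fset.
    by apply/fsubsetP => i _; apply: contrapT => /negP /nI.
  move=> /fsubset_leq_card; rewrite card_imfset //= size_enum_ord leqNgt => /negP; apply.
  apply: leq_ltn_trans (leq_imfset_card _ _ _) _ => /=.
  by apply: leq_trans (card_two_step x); rewrite (cardfsD1 y (two_step x)) xy.
have ci z : z \in S -> z \in two_step x -> c z <> i.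
  move=> zS xz cz; move: iP; rewrite -cz in_imfset //= !inE xz andbT.
  by apply: contraTneq zS => ->.
have two_step_sym z w : w \in two_step z -> z \in two_step w.
  by move=> /two_stepP[zw [t tz tw]]; apply/two_stepP; split; [exact/nesym|exists t].
exists (fun z => if z == x then i else c z) => z w zS wS zw.
have [zx|zx] := eqVneq z x; have [wx|wx] := eqVneq w x.
- by move: zw => /two_stepP[]; rewrite zx wx.
- by apply: nesym; apply: ci => //; rewrite -zx.
- by apply: ci => //; apply: two_step_sym; rewrite -wx.
- by apply: cP => //; rewrite !inE (zx, wx).
Qed.

Lemma rigid_coloring : exists a : V -> 'I_q,
  forall x y z, e z x -> e z y -> a x = a y -> x = y.
Proof.
have [c cP] := coloring_compactness rigid_finite.
exists c => x y z zx zy cxy; apply: contrapT => xy.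
have [F' [c' [F'x c'P c'c]]] := cP [fset x; y]%fset [fset x; y]%fset.
have xF : x \in F' by apply: (fsubsetP F'x); rewrite !inE eqxx.
have yF : y \in F' by apply: (fsubsetP F'x); rewrite !inE eqxx orbT.
have := c'P x y xF yF; rewrite !c'c ?inE ?eqxx ?orbT //; apply => //.
by apply/two_stepP; split => //; exists z.
Qed.

End LocallyFinite.

(** * Separating colourings of a graph *)

(** Put a point [x] in [T] and discard [x], its image and its preimage: each
    point of [T] costs at most three points of [B]. *)
Lemma displaced_subset (V : choiceType) (B : {fset V}) (f : V -> V) :
  {in B &, injective f} -> (forall x, x \in B -> f x <> x) ->
  exists T : {fset V}, [/\ (T `<=` B)%fset, (#|` B| <= 3 * #|` T|)%N &
    forall x, x \in T -> f x \notin T].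
Proof.
have [n] := ubnP #|` B|; elim: n B => // n IH B Bn finj fx.
have [->|/fset0Pn[x xB]] := eqVneq B fset0.
  by exists fset0; split => //; rewrite cardfs0.
pose Q := [fset z in B | f z == x]%fset.
pose N := ([fset x; f x] `|` Q)%fset.
have cQ : (#|` Q| <= 1)%N.
  have [->|/fset0Pn[y yQ]] := eqVneq Q fset0; first by rewrite cardfs0.
  rewrite -(cardfs1 y); apply/fsubset_leq_card/fsubsetP => z.
  move: yQ; rewrite !inE => /andP[yB /eqP fy] /andP[zB /eqP fz].
  by apply/eqP/finj => //; rewrite fy fz.
have cN : (#|` N| <= 3)%N.
  rewrite cardfsU (leq_trans (leq_subr _ _)) // cardfs2.
  by move: cQ; case: (_ != _); lia.
have xN : x \in N by rewrite !inE eqxx.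
have [|||T [TB cT Tf]] := IH (B `\` N)%fset.
- apply: leq_trans (_ : (#|` B| <= n)%N) => //.
  apply: fproper_ltn_card; rewrite fproperE fsubsetDl.
  by apply/negP => /fsubsetP/(_ x xB); rewrite inE xN.
- by move=> y z; rewrite !in_fsetD => /andP[_ yB] /andP[_ zB]; exact: finj.
- by move=> y; rewrite in_fsetD => /andP[_ yB]; exact: fx.
have xT : x \notin T by apply/negP => /(fsubsetP TB); rewrite in_fsetD xN.
exists (x |` T)%fset; split.
- apply/fsubsetP => y; rewrite !inE => /orP[/eqP -> //|/(fsubsetP TB)].
  by rewrite in_fsetD => /andP[].
- rewrite cardfsU1 xT -(cardfsID N B).
  have : (#|` (B `&` N)%fset| <= #|` N|)%N by apply/fsubset_leq_card/fsubsetIr.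
  move: cT cN; rewrite /=; lia.
- move=> y; rewrite !inE => /orP[/eqP ->|yT]; rewrite negb_or.
    apply/andP; split; first by apply/eqP; exact: fx.
    by apply/negP => /(fsubsetP TB); rewrite in_fsetD !inE eqxx orbT.
  rewrite Tf // andbT; have := fsubsetP TB y yT; rewrite in_fsetD => /andP[yN yB].
  by apply: contra yN => /eqP fy; rewrite !inE fy yB eqxx !orbT.
Qed.

Section Separation.
Variables (V : choiceType) (e : V -> V -> Prop) (D : nat).
Hypothesis esym : forall x y, e x y -> e y x.
Hypothesis edeg : forall x, ([set y | e x y] #<= `I_D)%card.
Hypothesis econn : forall x y, exists r, graph_ball e x r y.
Hypothesis Vinf : infinite_set [set: V]%classic.

Local Notation B := (graph_fball e).
Local Notation q := (D * (D - 1))%N.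

Let mul36_exp2 s : (9 <= s)%N -> (36 * s <= 2 ^ s)%N.
Proof.
elim: s => // s IH; rewrite leq_eqVlt => /orP[/eqP <- //|s9].
by have := IH s9; rewrite expnS; lia.
Qed.

(** The indices [2 d] and [2 d + 1] carry the radii [R] and [8 R] for the
    distance [d]. If both failed, the failure at [8 R] would bound
    [#|B u (8 R)|] by a multiple of [R], as balls grow at most exponentially;
    the failure at [R] would then bound [2 ^ R] by a power of [R]. The lower
    bound on [rho] makes the sum of the inverses of the radii small. *)
Lemma good_radii : exists rho : nat -> nat, (forall n, 2 ^ (n + 8) <= rho n)%N /\
  forall d u, exists2 n, n./2 = d & (#|` B u (8 * rho n)| ^ 18 <= 2 ^ #|` B u (rho n)|)%N.
Proof.
(* The ball of radius [64 R] has at most [2 ^ (64 * D * R)] points, whose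
   18th power is [2 ^ (K * R)]; the exponent 9 makes
   [18 * (K + s) <= 36 * s <= 2 ^ s] for [R = 2 ^ s]. *)
pose K := (64 * 18 * D)%N.
pose R d := (2 ^ (K + d.*2 + 9))%N.
exists (fun n => if odd n then 8 * R n./2 else R n./2)%N; split=> [n|d u].
  have n2 := odd_double_half n; rewrite -[X in (X + 8)%N]n2.
  case: odd; rewrite /R.
    rewrite (_ : 8 = 2 ^ 3)%N // -expnD leq_exp2l //; lia.
  by rewrite leq_exp2l //; lia.
have [ok|] := leqP (#|` B u (8 * R d)| ^ 18) (2 ^ #|` B u (R d)|).
  by exists d.*2; rewrite ?odd_double doubleK.
move=> small; exists d.*2.+1; rewrite /= ?odd_double ?uphalf_double //=.
rewrite leqNgt; apply/negP => small8.
have KR : (#|` B u (8 * R d)| < K * R d)%N.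
  rewrite -(ltn_exp2l _ _ (isT : 1 < 2)%N); apply: leq_trans small8 _.
  apply: (@leq_trans ((2 ^ (D * (8 * (8 * R d)))) ^ 18)).
    by rewrite leq_exp2r //; exact: card_graph_fball_le.
  by rewrite -expnM leq_exp2l // /K; lia.
have : (2 ^ R d < 2 ^ R d)%N.
  apply: (@ltn_trans (2 ^ #|` B u (R d)|)).
    by rewrite ltn_exp2l //; exact: card_graph_fball_gt.
  apply: leq_trans small _.
  apply: (@leq_trans ((2 ^ K * R d) ^ 18)).
    rewrite leq_exp2r //; apply: leq_trans (ltnW KR) _.
    by rewrite leq_mul2r (ltnW (ltn_expl _ _)) ?orbT.
  rewrite /R -expnD -expnM leq_exp2l //.
  by apply: leq_trans (mul36_exp2 _); lia.
by rewrite ltnn.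
Qed.

Let sum_pow2V_le (R : realFieldType) M :
  (\sum_(n < M) (2 ^ (n + 8))%N%:R^-1 <= 1 / 3 :> R)%R.
Proof.
have H : (\sum_(n < M) (2 ^ (n + 8))%N%:R^-1 <=
    1 / 128 - (1 / 128) * (2 ^ M)%N%:R^-1 :> R)%R.
  elim: M => [|M IH]; first by rewrite big_ord0 expn0 invr1 mulr1 subrr.
  rewrite big_ord_recr /= (_ : 2 ^ (M + 8) = 256 * 2 ^ M)%N; last first.
    by rewrite expnD mulnC.
  rewrite expnS !natrM !invfM; move: IH.
  set x := ((2 ^ M)%N%:R^-1)%R; set y := bigop _ _ _ => IH.
  lra.
apply: le_trans H _.
have : (0 <= (2 ^ M)%N%:R^-1 :> R)%R by rewrite invr_ge0.
by set x := (_ ^-1)%R => x0; lra.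
Qed.

Let pow23_le (R : realFieldType) t N : (0 < N)%N -> (N ^ 6 <= 2 ^ t)%N ->
  ((2 / 3) ^+ t <= (N%N%:R ^+ 3)^-1 :> R)%R.
Proof.
move=> N0 Nt; rewrite -(@ler_pXn2r _ 2) // ?nnegrE.
- rewrite -exprM mulnC exprM (_ : (2 / 3) ^+ 2 = 4 / 9 :> R)%R; last by field.
  apply: (@le_trans _ _ ((1 / 2) ^+ t)%R).
    by rewrite lerXn2r ?nnegrE //; lra.
  rewrite expr_div_n expr1n div1r exprVn -exprM lef_pV2 ?posrE.
  + by rewrite -!natrX ler_nat.
  + by rewrite exprn_gt0 // ltr0n.
  + by rewrite exprn_gt0 // ltr0n.
- by rewrite exprn_ge0 // divr_ge0.
- by rewrite invr_ge0 exprn_ge0.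
Qed.

(** The index [(n, (u, v))] stands for the pair [(u, v)] at distance at most
    [n./2], to be distinguished by the ball of radius [rho n]; [T] and [f] are
    the data of the event to be avoided by [b]. *)
Record separated_event (C : Type) (a : V -> C) (rho : nat -> nat)
    (i : nat * (V * V)) (T : {fset V}) (f : V -> V) : Prop := SeparatedEvent {
  event_near : graph_ball e i.2.1 i.1./2 i.2.2;
  event_radius :
    (#|` B i.2.1 (8 * rho i.1)| ^ 18 <= 2 ^ #|` B i.2.1 (rho i.1)|)%N;
  event_morphism : ball_morphism e a (rho i.1) i.2.1 i.2.2 f;
  event_sub : (T `<=` B i.2.1 (rho i.1))%fset;
  event_card : (#|` B i.2.1 (rho i.1)| <= 3 * #|` T|)%N;
  event_disjoint : forall x, x \in T -> f x \notin T
}.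

(** Fix [n] and let [N] be the number of points of the ball of radius [3 rho n]
    around [w]. Events of index [n] through [w] have [u] and [v] in that ball,
    so there are at most [N ^ 2] of them. The ball lies within distance
    [8 rho n] of each such [u], so [event_radius] gives [N ^ 18 <= 2 ^ (3 #|T|)]
    and each event weighs at most [1 / N ^ 3]. Together they weigh at most
    [1 / N <= 1 / rho n], which is summable in [n]. *)
Let event_sparse (R : realFieldType) (C : Type) (a : V -> C) rho
    (T : nat * (V * V) -> {fset V}) (f : nat * (V * V) -> V -> V)
    (F : {fset nat * (V * V)}) (w : V) :
  (forall n, 2 ^ (n + 8) <= rho n)%N ->
  (forall i, T i != fset0 -> separated_event a rho i (T i) (f i)) ->
  (\sum_(i <- F | w \in (T i `|` f i @` T i)%fset) (2 / 3) ^+ #|` T i|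
    <= 1 / 3 :> R)%R.
Proof.
move=> rhoP evP.
set P := fun i => w \in (T i `|` f i @` T i)%fset.
pose N n := #|` B w (3 * rho n)|.
have key i : P i -> [/\ i.2.1 \in B w (3 * rho i.1), i.2.2 \in B w (3 * rho i.1) &
    ((2 / 3) ^+ #|` T i| <= ((N i.1)%:R ^+ 3)^-1 :> R)%R].
  move: i => [n [u v]] /= Pi.
  have Ti : T (n, (u, v)) != fset0.
    by apply: contraTneq Pi; rewrite /P => ->; rewrite imfset0 fsetU0 inE.
  have [/= uv rad fm Tsub Tcard _] := evP _ Ti.
  have nrho : (n./2 <= rho n)%N.
    apply: leq_trans (rhoP n); apply: (@leq_trans (2 ^ n)).
      by have := ltn_expl n (isT : 1 < 2)%N; lia.
    by rewrite leq_exp2l //; lia.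
  have uw : graph_ball e u (2 * rho n) w.
    move: Pi; rewrite /P inE => /orP[/(fsubsetP Tsub)/(graph_fballP edeg) uw|].
      by apply: graph_ball_mono uw; lia.
    case/imfsetP => x /= /(fsubsetP Tsub)/(graph_fballP edeg) ux ->.
    have := graph_ball_trans uv (ball_morphism_ball fm (leqnn _) ux).
    by apply: graph_ball_mono; lia.
  have wu : graph_ball e w (3 * rho n) u.
    by apply: (@graph_ball_mono _ _ _ (2 * rho n)); [lia|exact: graph_ball_sym].
  have wv : graph_ball e w (3 * rho n) v.
    apply: (@graph_ball_mono _ _ _ (2 * rho n + n./2)); first by lia.
    by apply: graph_ball_trans uv; exact: graph_ball_sym.
  split; [exact/(graph_fballP edeg)|exact/(graph_fballP edeg)|].
  have Nu : (N n <= #|` B u (8 * rho n)|)%N.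
    apply/fsubset_leq_card/fsubsetP => x /(graph_fballP edeg) wx; apply/(graph_fballP edeg).
    apply: (@graph_ball_mono _ _ _ (2 * rho n + 3 * rho n)); first by lia.
    exact: graph_ball_trans uw wx.
  apply: pow23_le.
    apply: leq_ltn_trans (leq0n (3 * rho n)) _; exact: (card_graph_fball_gt edeg).
  rewrite -(@leq_exp2r _ _ 3) // -!expnM.
  apply: (@leq_trans (#|` B u (8 * rho n)| ^ 18)); first by rewrite leq_exp2r.
  by apply: leq_trans rad _; rewrite leq_exp2l // mulnC.
pose M := (\max_(i <- F) i.1)%N.
have MP i : i \in F -> (i.1 < M.+1)%N.
  by move=> iF; rewrite ltnS; apply: (leq_bigmax_seq (F := fst) i).
rewrite big_seq_cond (partition_big (fun i => inord i.1 : 'I_M.+1) xpredT) //=.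
apply: le_trans (sum_pow2V_le R M.+1); apply: ler_sum => n _.
pose Q i := (i \in F) && P i && (i.1 == n :> nat).
have QE i : (i \in F) && P i && (inord i.1 == n) = Q i.
  rewrite /Q; case iF : (i \in F) => //=; congr (_ && _).
  by rewrite -(inj_eq val_inj) /= inordK ?MP.
rewrite (eq_bigl _ _ QE).
have cQ : (count Q F <= N n ^ 2)%N.
  rewrite -size_filter -(size_map snd) /N -mulnn -(size_allpairs (@pair V V)).
  set s := [seq _ | _ <- _, _ <- _]; apply: (@uniq_leq_size _ _ s).
    rewrite map_inj_in_uniq ?filter_uniq ?fset_uniq //.
    move=> [m i] [m' i']; rewrite !mem_filter /Q /=.
    by move=> /andP[/andP[_ /eqP ->] _] /andP[/andP[_ /eqP ->] _] ->.
  move=> _ /mapP[[m [u v]] + ->]; rewrite mem_filter /Q /=.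
  move=> /andP[/andP[/andP[_ /key[/= uB vB _]] /eqP mn] _].
  by apply/allpairsP; exists (u, v); rewrite /= -mn.
apply: (@le_trans _ _ (\sum_(i <- F | Q i) ((N n)%:R ^+ 3)^-1)%R).
  by apply: ler_sum => i /andP[/andP[_ /key[_ _]]] + /eqP <-.
have N0 : (rho n < N n)%N.
  by apply: leq_ltn_trans (card_graph_fball_gt edeg econn Vinf w (3 * rho n)); lia.
have Npos : (0 < (N n)%:R :> R)%R by rewrite ltr0n; exact: leq_ltn_trans N0.
rewrite big_const_seq iter_addr_0 -[leLHS]mulr_natr.
apply: (@le_trans _ _ ((N n)%:R^-1)%R).
  apply: (@le_trans _ _ (((N n)%:R ^+ 3)^-1 * (N n ^ 2)%N%:R)%R).
    by apply: ler_wpM2l; [rewrite invr_ge0 exprn_ge0 // ltW|rewrite ler_nat].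
  rewrite natrX le_eqVlt; apply/orP; left; apply/eqP; field.
  by rewrite gt_eqF.
rewrite lef_pV2 ?posrE ?Npos ?ltr0n ?expn_gt0 // ler_nat.
exact: leq_trans (rhoP n) (ltnW N0).
Qed.

(** The exceptional value [fset0] of the chosen [T] marks the indices for which
    there is nothing to avoid. *)
Theorem separating_coloring : exists (c : V -> 'I_q * bool) (rad : nat -> nat),
  forall d u v f, u <> v -> graph_ball e u d v -> ~ ball_morphism e c (rad d) u v f.
Proof.
have [a arigid] := rigid_coloring esym edeg econn Vinf.
have [rho [rhoP radP]] := good_radii.
have /choice[Tf TfP] : forall i, exists Tf : {fset V} * (V -> V),
    (Tf.1 != fset0 -> i.2.1 <> i.2.2 /\ separated_event a rho i Tf.1 Tf.2) /\
    (Tf.1 = fset0 -> forall T f, T != fset0 -> i.2.1 <> i.2.2 ->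
       ~ separated_event a rho i T f).
  move=> i.
  have [[T [f [T0 [uv ev]]]]|nev] := pselect (exists T f,
      T != fset0 /\ i.2.1 <> i.2.2 /\ separated_event a rho i T f).
    by exists (T, f); split => //= T0'; rewrite T0' eqxx in T0.
  exists (fset0, id); split => /= [|_ T f T0 uv ev]; first by move=> /eqP.
  by apply: nev; exists T, f.
pose T i := (Tf i).1; pose g i := (Tf i).2.
have gm i x : x \in T i -> [/\ i.2.1 <> i.2.2, graph_ball e i.2.1 (rho i.1) x &
    separated_event a rho i (T i) (g i)].
  move=> xT; have /(TfP i).1[uv ev] : T i != fset0 by apply/fset0Pn; exists x.
  by split => //; apply/(graph_fballP edeg)/(fsubsetP (event_sub ev)).
have [|i x xT|F w|b bP] := @infinite_bicoloring rat V _ T g.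
- move=> i x y xT yT; have [_ ux [_ _ fm _ _ _]] := gm i x xT.
  by have [_ uy _] := gm i y yT; exact: (morph_inj fm).
- by have [_ _ [_ _ _ _ _]] := gm i x xT; apply.
- by apply: (event_sparse (a := a) _ _ _ rhoP) => i /(TfP i).1[].
exists (fun x => (a x, b x)), (fun d => rho d.*2 + rho d.*2.+1)%N.
move=> d u v f uv ud fm.
have [n nd rad] := radP d u.
have rn : (rho n <= rho d.*2 + rho d.*2.+1)%N.
  have := odd_double_half n; rewrite nd => <-.
  by case: odd; rewrite ?add1n ?add0n ?leq_addl ?leq_addr.
have fm' : ball_morphism e a (rho n) u v f.
  have [fu fi fe fc] := ball_morphism_le rn fm; split => // x ux.
  by have [] := fc x ux.
have [| |T' [T'B cT' T'f]] := @displaced_subset V (B u (rho n)) f.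
- by move=> x y /(graph_fballP edeg) ux /(graph_fballP edeg) uy; exact: (morph_inj fm').
- by move=> x /(graph_fballP edeg) ux fx; apply: uv; exact: rigid_fixpoint arigid _ _ _ _ _ fm' ux fx.
pose i := (n, (u, v)).
have ev : separated_event a rho i T' f by split => //=; rewrite nd.
have T'0 : T' != fset0.
  rewrite -cardfs_gt0; have := card_graph_fball_gt edeg econn Vinf u (rho n).
  by move: cT'; lia.
have Ti : T i != fset0.
  by apply: contraT; rewrite negbK => /eqP /(TfP i).2 /(_ T' f T'0 uv).
have [x xT] := bP i Ti; have [_ ux [_ _ gm' _ _ _]] := gm i x xT.
rewrite -(rigid_unique arigid fm' gm' ux).
have : graph_ball e u (rho d.*2 + rho d.*2.+1) x by apply: graph_ball_mono ux.
by move=> /(morph_color fm)[_ ->]; rewrite eqxx.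
Qed.

End Separation.

Local Open Scope classical_set_scope.

(** * Isomorphisms of patches and the graph of tiles *)

Section TilingGraph.
Variables (R : realType) (n : nat) (P : prototiles R n).

Lemma tile_ballE (X : metricType R) (A : tile_family P X) (l : tile_index A) r :
  tile_ball l r = graph_ball (@tile_adjacent R n P X A) l r.
Proof. by elim: r => //= r ->. Qed.

Lemma tile_adjacent_sym (X : metricType R) (A : tile_family P X)
    (l m : tile_index A) : tile_adjacent l m -> tile_adjacent m l.
Proof.
move=> [f [lm [fl fm] lmf mlf]]; exists (opp_face f); split.
- exact: nesym.
- by rewrite opp_faceK.
- by rewrite setIC.
- by rewrite setIC opp_faceK.
Qed.

Section Carries.
Variables (X Y : metricType R) (A : tiling P X) (B : tiling P Y).
Implicit Types (h : X -> Y) (l m : tile_index A).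

Lemma tile_nonempty l : tile l !=set0.
Proof.
have /(congr1 (fun S => S (mc_point (0 : 'rV_(mc_nvert _))%R))) :=
  tile_map_onto (tilingP A) l.
by rewrite propeqE => -[_ /(_ I)[x lx _]]; exists x.
Qed.

Lemma carries_type h l (l' : tile_index B) : carries_tile h l l' -> tile_type l' = tile_type l.
Proof.
move=> [_ hl]; have [x lx] := tile_nonempty l.
exact: (congr1 (fun s : {t : prototile P & tile_complex t} => tag s) (hl x lx)).
Qed.

(** Lying on the face [f] depends only on the value in the disjoint union of the
    prototiles, and this value is preserved. *)
Lemma carries_tile_face h l (l' : tile_index B) f : carries_tile h l l' ->
  tile_face l' f = h @` tile_face l f.
Proof.
pose marked (s : {t : prototile P & tile_complex t}) :=
  range (@face_incl _ _ P (tag s) f) (tagged s).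
move=> [hl vl]; apply/seteqP; split => [y|_ [x [lx fx] <-]].
  rewrite /tile_face -hl => -[[x lx <-]] fx; exists x => //; split => //.
  by have : marked (tile_val l' (h x)) by []; rewrite vl.
split; first by rewrite -hl; exists x.
by have : marked (tile_val l x) by []; rewrite -vl.
Qed.

Lemma carries_meet h l m (l' m' : tile_index B) f :
  {in tile l `|` tile m &, injective h} ->
  carries_tile h l l' -> carries_tile h m m' -> (l = m <-> l' = m') ->
  meet_along l m f <-> meet_along l' m' f.
Proof.
move=> hinj hl hm lm.
have himg (E F : set X) : E `<=` tile l `|` tile m -> F `<=` tile l `|` tile m ->
    h @` E = h @` F <-> E = F.
  move=> El Fl; split => [|->//] EF.
  have sub (S T : set X) : S `<=` tile l `|` tile m -> T `<=` tile l `|` tile m ->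
      h @` S = h @` T -> S `<=` T.
    move=> Sl Tl ST x Sx; have : (h @` T) (h x) by rewrite -ST; exists x.
    move=> [y Ty hxy]; suff <- : y = x by [].
    by apply: hinj => //; rewrite inE; [exact: Tl|exact: Sl].
  by apply/seteqP; split; apply: sub => //; exact/esym.
have hI : tile l' `&` tile m' = h @` (tile l `&` tile m).
  rewrite -(proj1 hl) -(proj1 hm); apply/seteqP; split => [_ [[x lx <-] [y my hyx]]|].
    exists x => //; split => //.
    suff <- : y = x by [].
    by apply: hinj => //; rewrite inE; [right|left].
  by move=> _ [x [lx mx] <-]; split; exists x.
have fl g : tile_face l g `<=` tile l `|` tile m by move=> x [lx _]; left.
have fm g : tile_face m g `<=` tile l `|` tile m by move=> x [mx _]; right.
have Il : tile l `&` tile m `<=` tile l `|` tile m by move=> x [lx _]; left.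
split=> -[nlm [fl1 fm1] e1 e2]; split.
- by move=> /lm.
- by rewrite (carries_type hl) (carries_type hm).
- by rewrite hI (carries_tile_face _ hl) e1.
- by rewrite hI (carries_tile_face _ hm) e2.
- by move=> /lm.
- by rewrite -(carries_type hl) -(carries_type hm).
- by apply/himg => //; rewrite -hI -(carries_tile_face _ hl).
- by apply/himg => //; rewrite -hI -(carries_tile_face _ hm).
Qed.

Lemma carries_adjacent h l m (l' m' : tile_index B) :
  {in tile l `|` tile m &, injective h} ->
  carries_tile h l l' -> carries_tile h m m' -> (l = m <-> l' = m') ->
  tile_adjacent l m <-> tile_adjacent l' m'.
Proof.
move=> hinj hl hm lm; split=> -[f lmf]; exists f;
  by apply/(carries_meet f hinj hl hm lm).
Qed.

End Carries.

Lemma isometry_on_inj (X Y : metricType R) (S : set X) (h : X -> Y) :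
  isometry_on S h -> {in S &, injective h}.
Proof.
move=> hS x y; rewrite !inE => Sx Sy hxy; apply: mdist_positivity.
by rewrite -hS // hxy mdistxx.
Qed.

Definition patch_iso (X Y : metricType R) (A : tiling P X) (B : tiling P Y)
    (t : tile_index A) (s : tile_index B) (r : nat)
    (h : X -> Y) (phi : tile_index A -> tile_index B) : Prop :=
  [/\ isometry_on (Defs.patch t r) h,
      h @` Defs.patch t r = Defs.patch s r,
      h @` tile t = tile s,
      set_bij (tile_ball t r) (tile_ball s r) phi &
      forall l, tile_ball t r l -> carries_tile h l (phi l)].

Section PatchIso.
Variables (X Y : metricType R) (A : tiling P X) (B : tiling P Y).
Variables (t : tile_index A) (s : tile_index B) (r : nat) (h : X -> Y).
Variable phi : tile_index A -> tile_index B.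
Hypothesis iso : patch_iso t s r h phi.

Local Notation adjA := (@tile_adjacent R n P X A).
Local Notation adjB := (@tile_adjacent R n P Y B).

Lemma patch_iso_center : phi t = s.
Proof.
have [_ _ hts _ carr] := iso; apply: (tile_inj (tilingP B)).
have tt : tile_ball t r t by rewrite tile_ballE; exact: graph_ball_center.
by rewrite -hts; have [-> _] := carr t tt.
Qed.

Lemma patch_iso_inj l m : tile_ball t r l -> tile_ball t r m ->
  phi l = phi m -> l = m.
Proof. by have [_ _ _ [_ inj _] _] := iso => tl tm; apply: inj; rewrite inE. Qed.

Lemma patch_iso_type l : tile_ball t r l -> tile_type (phi l) = tile_type l.
Proof. by have [_ _ _ _ carr] := iso => /carr /carries_type. Qed.

Lemma patch_iso_adjacent l m : tile_ball t r l -> tile_ball t r m ->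
  adjA l m <-> adjB (phi l) (phi m).
Proof.
have [hiso _ _ _ carr] := iso => tl tm.
apply: (carries_adjacent _ (carr l tl) (carr m tm)); last first.
  by split=> [->//|]; exact: patch_iso_inj.
move=> x y xlm ylm; apply: (isometry_on_inj hiso); rewrite inE.
- by move: xlm; rewrite inE => -[]; [exists l|exists m].
- by move: ylm; rewrite inE => -[]; [exists l|exists m].
Qed.

Lemma patch_iso_ball a l j m : tile_ball t a l -> (a + j <= r)%N ->
  tile_ball l j m -> tile_ball (phi l) j (phi m).
Proof.
rewrite !tile_ballE => tl; elim: j m => [|j IH] m ajr; first by move=> ->.
have sub k : graph_ball adjA l j k -> tile_ball t r k.
  rewrite tile_ballE => lk; apply: (@graph_ball_mono _ _ _ (a + j)); first by lia.
  exact: graph_ball_trans lk.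
move=> [lm|[k lk km]]; first by left; apply: IH => //; lia.
apply: (graph_ball_edge (y := phi k)); first by apply: IH => //; lia.
apply/patch_iso_adjacent => //; first exact: sub.
rewrite tile_ballE; apply: graph_ball_mono ajr _; rewrite addnS.
exact: graph_ball_edge (graph_ball_trans tl lk) km.
Qed.

(** Balls around tiles well inside the patch are mapped onto balls because
    adjacency is reflected as well as preserved. *)
Lemma patch_iso_preimage a l j y : tile_ball t a l -> (a + j <= r)%N ->
  tile_ball (phi l) j y -> exists2 m, tile_ball l j m & phi m = y.
Proof.
move=> tl; elim: j y => [|j IH] y ajr; first by move=> ->; exists l.
case=> [ly|[k lk ky]].
  have [|m lm <-] := IH y _ ly; first by lia.
  by exists m => //; left.
have [|k' lk' k'E] := IH k _ lk; first by lia.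
have tk' : tile_ball t (a + j) k'.
  by move: tl lk'; rewrite !tile_ballE; exact: graph_ball_trans.
have sy : tile_ball s r y.
  rewrite tile_ballE; apply: (graph_ball_mono ajr); rewrite addnS -tile_ballE.
  right; exists k => //.
  rewrite -patch_iso_center -k'E; apply: (@patch_iso_ball 0) tk'; last by lia.
  by [].
have [_ _ _ [_ _ surj] _] := iso; have [m tm my] := surj y sy.
exists m => //; right; exists k' => //; apply/patch_iso_adjacent => //.
  by move: tk'; rewrite !tile_ballE; apply: graph_ball_mono; lia.
by rewrite k'E my.
Qed.

Lemma patch_iso_sub a l j : tile_ball t a l -> (a + j <= r)%N ->
  patch_iso l (phi l) j h phi.
Proof.
move=> tl ajr; have [hiso _ _ _ carr] := iso.
have sub m : tile_ball l j m -> tile_ball t r m.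
  rewrite !tile_ballE in tl * => lm; apply: graph_ball_mono ajr _.
  exact: graph_ball_trans tl lm.
have carr' m : tile_ball l j m -> carries_tile h m (phi m).
  by move=> /sub; exact: carr.
split => //.
- move=> x y [m lm mx] [m' lm' m'y]; apply: hiso; [exists m|exists m'] => //; exact: sub.
- apply/seteqP; split => [_ [x [m lm mx] <-]|y [m' lm' m'y]].
    exists (phi m); first exact: patch_iso_ball tl ajr lm.
    by rewrite -(proj1 (carr' m lm)); exists x.
  have [m lm mE] := patch_iso_preimage tl ajr lm'.
  move: m'y; rewrite -mE -(proj1 (carr' m lm)) => -[x mx <-].
  by exists x => //; exists m.
- by have [] := carr' l _; rewrite ?tile_ballE //; exact: graph_ball_center.
- split => [m lm|m m'|y ly]; first exact: patch_iso_ball tl ajr lm.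
    by rewrite !inE => /sub tm /sub tm'; exact: patch_iso_inj.
  by have [m lm mE] := patch_iso_preimage tl ajr ly; exists m.
Qed.

End PatchIso.

Lemma patch_iso_id (X : metricType R) (A : tiling P X) (t : tile_index A) r :
  patch_iso t t r id id.
Proof.
split; rewrite ?image_id //; last by move=> l _; split; rewrite ?image_id.
by split=> [l|l m _ _|l tl] //; exists l.
Qed.

Lemma patch_iso_comp (X Y Z : metricType R) (A : tiling P X) (B : tiling P Y)
    (D : tiling P Z) (t : tile_index A) (s : tile_index B) (w : tile_index D)
    r h h' phi phi' :
  patch_iso t s r h phi -> patch_iso s w r h' phi' ->
  patch_iso t w r (h' \o h) (phi' \o phi).
Proof.
move=> [iso img c [f i su] carr] [iso' img' c' [f' i' su'] carr']; split.
- move=> x y tx ty /=; rewrite iso' ?iso // -img; [by exists x|by exists y].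
- by rewrite -image_comp img img'.
- by rewrite -image_comp c c'.
- split=> [l tl|l m|y wy].
  + by apply: f'; apply: f.
  + rewrite !inE => tl tm E; apply: i; rewrite ?inE //.
    by apply: i'; rewrite ?inE //; exact: f.
  + have [k sk <-] := su' y wy; have [l tl <-] := su k sk; by exists l.
- move=> l tl; have [hl vl] := carr l tl; have [hl' vl'] := carr' (phi l) (f l tl).
  split; first by rewrite -image_comp hl hl'.
  move=> x lx /=; rewrite vl' ?vl // -hl; by exists x.
Qed.

End TilingGraph.

(** * Coloured tilings *)

Section Colored.
Variables (R : realType) (n : nat) (P : prototiles R n) (C : finType) (c0 : C).

(** The colour [c0] only serves to exhibit a prototile for each face. *)
Definition colored_prototiles : prototiles R n := @Prototiles R n
  (prototile P * C)%type (face P) (fun t => tile_complex t.1)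
  (@face_complex R n P) (fun t => faces t.1)
  (fun t f => @face_incl R n P t.1 f) (@opp_face R n P)
  (fun t => @prototile_compact R n P t.1)
  (fun t => @prototile_connected R n P t.1)
  (fun t => @prototile_dim R n P t.1)
  (@face_dim R n P)
  (fun f => let: ex_intro t ft := face_of_prototile f in
     ex_intro _ (t, c0) ft)
  (fun t => @face_subcomplex R n P t.1)
  (fun t => @face_incl_inj R n P t.1)
  (@opp_faceK R n P).

Lemma max_faces_colored : (max_faces P <= max_faces colored_prototiles)%N.
Proof.
apply/bigmax_leqP => t _.
exact: (@leq_bigmax (prototile colored_prototiles) (fun t => #|faces t|) (t, c0)).
Qed.

Definition colored_family (X : metricType R) (A : tile_family P X)
    (c : tile_index A -> C) : tile_family colored_prototiles X :=
  @TileFamily R n colored_prototiles X (tile_index A) (@tile _ _ _ _ A)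
    (fun l => (tile_type l, c l)) (fun l => @tile_map _ _ _ _ A l).

Lemma colored_axioms (X : metricType R) (A : tiling P X)
    (c : tile_index A -> C) : tiling_axioms (colored_family c).
Proof.
have [tinj tiso tonto tcov tint tmeet tfree tconn tdeg] := tilingP A.
split => // l; apply: card_le_trans (tdeg l) _.
by rewrite card_le_II max_faces_colored.
Qed.

Definition colored (X : metricType R) (A : tiling P X) (c : tile_index A -> C) :
  tiling colored_prototiles X := Tiling (colored_axioms c).

Lemma tile_ball_colored (X : metricType R) (A : tiling P X) (c : tile_index A -> C) l r :
  @tile_ball _ _ _ _ (colored c) l r = @tile_ball _ _ _ _ A l r.
Proof. by rewrite !tile_ballE. Qed.

Lemma colored_patch_iso (X Y : metricType R) (A : tiling P X) (B : tiling P Y)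
    (c : tile_index A -> C) (d : tile_index B -> C) t s r h phi :
  @patch_iso _ _ _ _ _ (colored c) (colored d) t s r h phi <->
  @patch_iso _ _ _ _ _ A B t s r h phi /\
  forall l, @tile_ball _ _ _ _ A t r l -> d (phi l) = c l.
Proof.
have patchE (Z : metricType R) (D : tiling P Z) (b : tile_index D -> C) w :
    @Defs.patch _ _ _ _ (colored b) w r = @Defs.patch _ _ _ _ D w r.
  by rewrite /Defs.patch tile_ball_colored.
rewrite /patch_iso !patchE !tile_ball_colored.
split=> [iso|[[iso img c1 bij carr] cd]].
  have col l : tile_ball t r l -> d (phi l) = c l.
    have [_ _ _ _ carr] := iso.
    by move=> /carr /carries_type [].
  split => //; have [isom img c1 bij carr] := iso; split => // l tl.
  have [hl vl] := carr l tl; split => // x lx.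
  have := congr1 (fun s : {t : prototile colored_prototiles & tile_complex t} =>
    existT (fun t => mc_space (tile_complex t)) (tag s).1 (tagged s)
      : {t : prototile P & tile_complex t}) (vl x lx).
  by [].
split => // l tl; have [hl vl] := carr l tl; split => // x lx.
have := congr1 (fun s : {t : prototile P & tile_complex t} =>
    existT (fun t : prototile colored_prototiles => mc_space (tile_complex t))
      ((tag s, c l) : prototile colored_prototiles) (tagged s)
      : {t : prototile colored_prototiles & tile_complex t}) (vl x lx).
by rewrite /tile_val /= cd.
Qed.

End Colored.

(** * Separated tilings *)

Section Separated.
Variables (R : realType) (n : nat) (P : prototiles R n).

(** Types play the role of colours. *)
Definition separated (X : metricType R) (A : tiling P X) (rad : nat -> nat) : Prop :=
  forall d (u v : tile_index A) f, u <> v -> tile_ball u d v ->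
  ~ ball_morphism (@tile_adjacent R n P X A) (@tile_type R n P X A) (rad d) u v f.

(** A forbidden morphism in [B] involves a bounded part of a patch around [s];
    conjugating it by a patch isomorphism gives one in [A]. The tiling [A] may
    depend on the radius, so that limits of varying colourings are covered. *)
Lemma separated_limit (X Y : metricType R) (B : tiling P Y) (s : tile_index B)
    rad :
  (forall r, exists (A : tiling P X) (t : tile_index A),
     separated A rad /\ patch_isomorphic t s r) ->
  separated B rad.
Proof.
move=> lim d u v f uv uvd fm.
have [a su] := tile_graph_connected (tilingP B) s u.
pose r := (a + d + rad d)%N.
have [A [t [sepA [h [phi iso]]]]] := lim r.
have phit := patch_iso_center iso.
have tt : tile_ball t 0 t by [].
have ar : (0 + a <= r)%N by rewrite /r; lia.
rewrite -phit in su.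
have [u' tu' u'E] := patch_iso_preimage iso tt ar su; subst u.
have adr : (a + d <= r)%N by rewrite /r; lia.
have [v' uv' v'E] := patch_iso_preimage iso tu' adr uvd; subst v.
rewrite phit in su.
have subB y : tile_ball (phi v') (rad d) y -> tile_ball s r y.
  rewrite !tile_ballE in su uvd * => vy.
  exact: graph_ball_trans (graph_ball_trans su uvd) vy.
have subA x : tile_ball u' (rad d) x -> tile_ball t r x.
  rewrite !tile_ballE in tu' * => ux; apply: (@graph_ball_mono _ _ _ (a + rad d)).
    by rewrite /r; lia.
  exact: graph_ball_trans tu' ux.
have [_ _ _ [_ _ surj] _] := iso.
have /choice[psi psiP] : forall y, exists x, tile_ball s r y ->
    tile_ball t r x /\ phi x = y.
  move=> y; have [/surj[x tx xy]|sy] := pselect (tile_ball s r y); last by exists t.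
  by exists x.
have fB x : tile_ball u' (rad d) x -> tile_ball s r (f (phi x)).
  move=> ux; apply: subB; rewrite tile_ballE.
  apply: (ball_morphism_ball fm) => //; rewrite -tile_ballE.
  by apply: (patch_iso_ball iso tu') => //; rewrite /r; lia.
have phiB x : tile_ball u' (rad d) x -> tile_ball (phi u') (rad d) (phi x).
  by apply: (patch_iso_ball iso tu'); rewrite /r; lia.
apply: (sepA d u' v' (fun x => psi (f (phi x)))) => //.
  by move=> uv'E; apply: uv; rewrite uv'E.
have tv' : tile_ball t r v'.
  rewrite !tile_ballE in tu' uv' *; apply: (@graph_ball_mono _ _ _ (a + d)).
    by rewrite /r; lia.
  exact: graph_ball_trans tu' uv'.
split.
- rewrite (morph_center fm); apply: (patch_iso_inj iso) => //.
    by have [] := psiP (phi v') (subB _ _) => //; rewrite tile_ballE; exact: graph_ball_center.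
  by have [] := psiP (phi v') (subB _ _) => //; rewrite tile_ballE; exact: graph_ball_center.
- move=> x y; rewrite -!tile_ballE => ux uy E.
  apply: (patch_iso_inj iso); [exact: subA|exact: subA|].
  apply: (morph_inj fm); rewrite -?tile_ballE; [exact: phiB|exact: phiB|].
  by rewrite -(proj2 (psiP _ (fB x ux))) -(proj2 (psiP _ (fB y uy))) E.
- move=> x y; rewrite -!tile_ballE => ux uy xy.
  have [tx ex] := psiP _ (fB x ux); have [ty ey] := psiP _ (fB y uy).
  apply/(patch_iso_adjacent iso tx ty); rewrite ex ey.
  apply: (morph_edge fm); rewrite -?tile_ballE; [exact: phiB|exact: phiB|].
  by apply/(patch_iso_adjacent iso) => //; exact: subA.
- move=> x; rewrite -!tile_ballE => ux.
  have [tx ex] := psiP _ (fB x ux).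
  rewrite -(patch_iso_type iso tx) ex (morph_color fm) -?tile_ballE; last exact: phiB.
  by rewrite (patch_iso_type iso) //; exact: subA.
Qed.

Lemma separated_aperiodic (Y : metricType R) (B : tiling P Y) rad :
  separated B rad -> aperiodic B.
Proof.
move=> sep h hiso hbij [phi phibij carr].
have hinj : injective h.
  by move=> x y; apply: (isometry_on_inj hiso); rewrite inE.
have phi_id m : phi m = m.
  apply: contrapT => pm; have [d md] := tile_graph_connected (tilingP B) m (phi m).
  apply: (sep d m (phi m) phi) => //; first exact: nesym.
  split=> //.
  - by move=> x y _ _; exact: bij_inj.
  - move=> x y _ _ xy; apply/(carries_adjacent _ (carr x) (carr y)) => //.
    by move=> ? ? _ _; exact: hinj.
    by split=> [->//|]; exact: bij_inj.
  - by move=> x _; exact: carries_type (carr x).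
apply/funext => x.
have : [set: Y] x by []; rewrite -(tile_cover (tilingP B)) => -[m _ mx].
have := carr m; rewrite phi_id => -[hm vm].
apply: (isometry_on_inj (@tile_map_isometry _ _ _ _ _ (tilingP B) m)); rewrite ?inE //=.
  by rewrite -hm; exists x.
exact: (eq_from_Tagged (vm x mx)).
Qed.

End Separated.

Section PatchIsomorphic.
Variables (R : realType) (n : nat) (P : prototiles R n).

Lemma patch_isomorphic_comp (X Y Z : metricType R) (A : tiling P X)
    (B : tiling P Y) (D : tiling P Z) (t : tile_index A) (s : tile_index B)
    (w : tile_index D) r :
  patch_isomorphic t s r -> patch_isomorphic s w r -> patch_isomorphic t w r.
Proof.
move=> [h [phi iso]] [h' [phi' iso']]; exists (h' \o h), (phi' \o phi).
exact: patch_iso_comp iso iso'.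
Qed.

Lemma patch_isomorphic_le (X Y : metricType R) (A : tiling P X)
    (B : tiling P Y) (t : tile_index A) (s : tile_index B) r r' :
  (r' <= r)%N -> patch_isomorphic t s r -> patch_isomorphic t s r'.
Proof.
move=> r'r [h [phi iso]]; exists h, phi; rewrite -(patch_iso_center iso).
exact: (patch_iso_sub (a := 0) iso).
Qed.

(** A patch that occurs in a patch of [B] occurs in every copy of the latter. *)
Lemma patch_isomorphic_preimage (X Y : metricType R) (A : tiling P X)
    (B : tiling P Y) (t : tile_index A) (s : tile_index B) a r y :
  patch_isomorphic t s (a + r) -> tile_ball s a y ->
  exists2 u, tile_ball t a u & patch_isomorphic u y r.
Proof.
move=> [h [phi iso]] sy.
have tt : tile_ball t 0 t by [].
rewrite -(patch_iso_center iso) in sy.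
have [u tu <-] := patch_iso_preimage iso tt (leq_addr r a) sy.
by exists u => //; exists h, phi; exact: (patch_iso_sub iso tu).
Qed.

End PatchIsomorphic.

Lemma tile_ball_finite (R : realType) (n : nat) (P : prototiles R n)
    (X : metricType R) (A : tiling P X) (l : tile_index A) r :
  finite_set (tile_ball l r).
Proof.
rewrite tile_ballE.
exact: (@graph_ball_finite {classic tile_index A} _ _
  (tile_graph_degree (tilingP A))).
Qed.

(** * Repetitive colourings *)

Section RepetitiveColoring.
Variables (R : realType) (n : nat) (P : prototiles R n) (C : finType) (c0 : C).
Variables (X : metricType R) (A : tiling P X) (rad : nat -> nat).
Local Notation V := (tile_index A).
Local Notation colA c := (colored c0 (A := A) c).
Local Notation ciso c c' t t' r :=
  (@patch_isomorphic R n _ X X (colA c) (colA c') t t' r).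

Lemma eq_colored_iso (c c' : V -> C) (t : V) r :
  (forall l, @tile_ball _ _ _ _ A t r l -> c l = c' l) -> ciso c c' t t r.
Proof.
move=> cc'; exists id, id; apply/colored_patch_iso; split.
  exact: patch_iso_id.
by move=> l tl; rewrite cc'.
Qed.

Lemma colored_iso_pushforward (c : V -> C) (t s : V) r :
  @patch_isomorphic R n P X X A A t s r -> exists c', ciso c c' t s r.
Proof.
move=> [h [phi iso]]; have [_ _ _ [_ inj surj] _] := iso.
have /choice[psi psiP] : forall y, exists x, tile_ball s r y ->
    tile_ball t r x /\ phi x = y.
  move=> y; have [/surj[x tx xy]|sy] := pselect (tile_ball s r y); last by exists t.
  by exists x.
exists (c \o psi), h, phi; apply/colored_patch_iso; split => //= l tl; congr c.
have sl : tile_ball s r (phi l) by have [_ _ _ [f _ _] _] := iso; exact: f.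
have [tpl pl] := psiP _ sl; exact: (patch_iso_inj iso).
Qed.

Variable t0 : V.
Hypothesis t0rep : forall r0, exists2 r, (r0 <= r)%N &
  exists d, forall l : V, exists2 t : V,
    @tile_ball _ _ _ _ A l d t & @patch_isomorphic R n P X X A A t t0 r.

(** A pair [(r, c)] in [F] stands for the pattern of [c] on the patch of radius
    [r] around [t0]. *)
Let admissible (F : set (nat * (V -> C))) (c : V -> C) :=
  separated (colA c) rad /\
  forall p, F p -> forall t, ~ ciso c p.2 t t0 p.1.

Let admissible_limit F c' :
  (forall r, exists c t, admissible F c /\ ciso c c' t t0 r) -> admissible F c'.
Proof.
move=> lim; split.
  apply: (@separated_limit _ _ _ X _ (colA c') t0) => r.
  by have [c [t [[sepc _] iso]]] := lim r; exists (colA c), t.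
move=> p Fp t tp.
have [a t0t] := tile_graph_connected (tilingP (colA c')) t0 t.
have [c [w [[_ cF] iso]]] := lim (a + p.1)%N.
have [u wu ut] := patch_isomorphic_preimage iso t0t.
exact: (cF p Fp u (patch_isomorphic_comp ut tp)).
Qed.

(** Zorn's lemma applies because admissibility concerns one finite patch at a
    time, hence passes to a limit of colourings along a chain of sets [F]. *)
Lemma repetitive_coloring (c : V -> C) : separated (colA c) rad ->
  exists c', separated (colA c') rad /\ repetitive (colA c').
Proof.
move=> sepc.
have [|F [[c1 adm] Fmax]] := @Zorn_bigcup _ [set F | exists c, admissible F c].
  move=> G GK Gtot.
  have [G0|/nonemptyPn ->] := pselect (G !=set0); last first.
    by rewrite bigcup_set0; exists c; split.
  have /choice[cG cGP] : forall F, exists c', G F -> admissible F c'.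
    move=> F; have [/GK[c' Fc']|] := pselect (G F); first by exists c'.
    by exists c.
  pose U := filter_from G (fun F => [set F' | G F' /\ F `<=` F']).
  have UF : ProperFilter U.
    apply: filter_from_proper => [|F GF]; last by exists F; split.
    apply: filter_from_filter => [|F F' GF GF']; first by have [F GF] := G0; exists F.
    have [FF'|F'F] := Gtot _ _ GF GF'.
      exists F' => // F'' [GF'' sub]; split; split => //.
      exact: subset_trans FF' sub.
    exists F => // F'' [GF'' sub]; split; split => //.
    exact: subset_trans F'F sub.
  have [c' c'P] := coloring_cluster cG UF.
  exists c'.
  have adm F : G F -> admissible F c'.
    move=> GF; apply: admissible_limit => r.
    have [||F' [GF' FF'] cF'] := c'P (@tile_ball _ _ _ _ A t0 r) [set F' | G F' /\ F `<=` F'].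
    - exact: tile_ball_finite.
    - by exists F.
    exists (cG F'), t0; split; last exact: eq_colored_iso.
    by have [sep av] := cGP F' GF'; split => // p /FF'; exact: av.
  have [F GF] := G0; split; first by have [] := adm F GF.
  by move=> p [F' GF' pF']; have [_ av] := adm F' GF'; exact: av.
have [sep1 av1] := adm.
exists c1; split => //; exists t0 => r0; exists r0 => //.
apply: contrapT => /forallNP nrep.
(* The pattern of radius [r0] of [c1] is assumed to miss balls of every radius
   [d]. *)
have nocc d : exists l : V, forall t, @tile_ball _ _ _ _ A l d t -> ~ ciso c1 c1 t t0 r0.
  have := nrep d; move=> /existsNP[l nl]; exists l => t lt tt0.
  by apply: nl; exists t => //; rewrite tile_ball_colored.
have /choice[ct ctP] : forall rho, exists ct : (V -> C) * V,
    ciso c1 ct.1 ct.2 t0 rho /\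
    forall t, @tile_ball _ _ _ _ A ct.2 rho t -> ~ ciso c1 c1 t t0 r0.
  move=> rho; have [r rho_r [d rep]] := t0rep rho.
  have [l nl] := nocc (d + r)%N; have [t lt iso] := rep l.
  have [c' iso'] := colored_iso_pushforward c1 iso.
  exists (c', t); split => /=; first exact: patch_isomorphic_le rho_r iso'.
  move=> t' tt'; apply: nl; rewrite !tile_ballE in lt tt' *.
  apply: graph_ball_trans lt _; exact: graph_ball_mono rho_r tt'.
(* The limit [c'] of the transported colourings inherits the absence of the
   pattern [(r0, c1)], which contradicts the maximality of [F]. *)
have [c' c'P] := coloring_cluster (fun rho => (ct rho).1) eventually_filter.
have lim r : exists2 rho, (r <= rho)%N & ciso c1 c' (ct rho).2 t0 r.
  have [||rho /= rrho eqc] := c'P (@tile_ball _ _ _ _ A t0 r) [set rho | (r <= rho)%N].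
  - exact: tile_ball_finite.
  - exact: nbhs_infty_ge.
  exists rho => //; have [iso _] := ctP rho.
  by apply: patch_isomorphic_comp (patch_isomorphic_le rrho iso) _; exact: eq_colored_iso.
have adm' : admissible F c'.
  by apply: admissible_limit => r; have [rho _ iso] := lim r; exists c1, (ct rho).2.
apply: (Fmax (F `|` [set (r0, c1)])).
  split; first by move=> p Fp; left.
  move=> /(_ (r0, c1)) sub; apply: (av1 (r0, c1) (sub _) t0); first by right.
  exact: eq_colored_iso.
exists c'; have [sep' av'] := adm'; split => // p [/av'//|-> t /= tt0].
have [a t0t] := tile_graph_connected (tilingP (colA c')) t0 t.
have [rho arho iso] := lim (a + r0)%N.
have [u wu ut] := patch_isomorphic_preimage iso t0t.
have [_ /(_ u)] := ctP rho; apply; last exact: patch_isomorphic_comp ut tt0.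
rewrite tile_ball_colored !tile_ballE in wu *; apply: graph_ball_mono wu; lia.
Qed.

End RepetitiveColoring.

(** * Existence of separated colourings, and the theorem *)

(** A tile is an isometric image of a compact prototile. *)
Lemma tile_index_infinite (R : realType) (n : nat) (P : prototiles R n)
    (X : metricType R) (A : tiling P X) :
  ~ compact [set: X] -> infinite_set [set: tile_index A].
Proof.
move=> ncX fin; apply: ncX; rewrite -(tile_cover (tilingP A)).
have /finite_seqP[s sE] : finite_set [set: {classic tile_index A}] by exact: fin.
have -> : \bigcup_l @tile _ _ _ _ A l =
    \big[setU/set0]_(l <- s) @tile _ _ _ _ A l by rewrite -bigcup_seq -sE.
apply: bigsetU_compact => l _.
have /choice[g gP] : forall z, exists x : X, tile l x /\ tile_map l x = z.
  move=> z; have : [set: tile_complex (tile_type l)] z by [].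
  by rewrite -(tile_map_onto (tilingP A) l) => -[x lx xz]; exists x.
have -> : tile l = range g.
  apply/seteqP; split => [x lx|_ [z _ <-]]; last by have [] := gP z.
  exists (tile_map l x) => //; have [lg gE] := gP (tile_map l x).
  by apply: (isometry_on_inj (@tile_map_isometry _ _ _ _ _ (tilingP A) l)); rewrite ?inE.
apply: continuous_compact; last exact: prototile_compact.
apply: continuous_subspaceT => z; apply/metricType_numDomainType.cvgrPdist_lt => eps eps0.
have [lz zE] := gP z.
near=> w; have [lw wE] := gP w.
rewrite -(@tile_map_isometry _ _ _ _ _ (tilingP A) l) // zE wE.
near: w; apply/metricType_numDomainType.nbhs_mdistP; exists eps => //=.
Unshelve. all: by end_near. Qed.

Section Main.
Variables (R : realType) (n : nat) (P : prototiles R n) (X : metricType R).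
Hypothesis ncX : ~ compact [set: X].
Local Notation D := (max_faces P).
Local Notation color := ('I_(D * (D - 1)) * bool)%type.

Lemma card_colored_prototiles (c0 : color) :
  #|prototile (colored_prototiles P c0)| = (2 * #|prototile P| * D * (D - 1))%N.
Proof. by rewrite card_prod card_prod card_ord card_bool; lia. Qed.

Lemma separated_coloring (A : tiling P X) : exists c0 (c : tile_index A -> color) rad,
  separated (colored c0 c) rad.
Proof.
have conn (l m : tile_index A) : exists r, graph_ball (@tile_adjacent R n P X A) l r m.
  by have [r lm] := tile_graph_connected (tilingP A) l m; exists r; rewrite -tile_ballE.
have inf := tile_index_infinite (A := A) ncX.
have [c [rad crad]] := @separating_coloring {classic tile_index A} _ _
  (@tile_adjacent_sym R n P X A) (tile_graph_degree (tilingP A)) conn inf.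
have [l0 _] := infinite_setN0 inf.
exists (c l0), c, rad => d u v f uv; rewrite tile_ballE => uvd [fu fi fe fc].
by apply: (crad d u v f uv uvd); split => // x /fc [].
Qed.

End Main.

Lemma separated_limit_aperiodic (R : realType) (n : nat) (P : prototiles R n)
    (X : metricType R) (A : tiling P X) rad :
  separated A rad -> limit_aperiodic A.
Proof.
move=> sep Y B s lim; apply: (@separated_aperiodic _ _ _ _ _ rad).
by apply: (@separated_limit _ _ _ X _ _ s) => r; have [t iso] := lim r; exists A, t.
Qed.

Unset Implicit Arguments.

Theorem corollary1p8 (R : realType) (n : nat) (P : prototiles R n)
    (X : metricType R) (hX : ~ compact [set: X]) :
  let k := (2 * #|prototile P| * max_faces P * (max_faces P - 1))%N in
  (inhabited (tiling P X) ->
     exists P' : prototiles R n, (#|prototile P'| <= k)%N /\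
       exists A' : tiling P' X, limit_aperiodic A') /\
  ((exists A : tiling P X, repetitive A) ->
     exists P' : prototiles R n, (#|prototile P'| <= k)%N /\
       exists A' : tiling P' X, repetitive A' /\ limit_aperiodic A').
Proof.
split=> [[A]|[A [t0 t0rep]]]; have [c0 [c [rad sep]]] := separated_coloring hX A;
  exists (colored_prototiles P c0); rewrite card_colored_prototiles; split=> //.
- by exists (colored c0 c); exact: separated_limit_aperiodic sep.
- have [c' [sep' rep']] := repetitive_coloring t0rep sep.
  exists (colored c0 c'); split=> //; exact: separated_limit_aperiodic sep'.
Qed.
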